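(* Let $X$ be an $L$-dimensional zero-mean Gaussian random vector with covariance $\Sigma_X=\Theta^T\Lambda_X\Theta\succ0$, where $\Theta$ is unitary and $\Lambda_X=\mathrm{diag}(\lambda_1,\ldots,\lambda_L)$ with $\lambda_\ell>0$. With the squared Wasserstein-2 distance $W_2^2(P_X,P_{\hat X})$ as the perception metric, the rate-distortion-perception function $R(D,P)$ is given by $$R(D,P)=\min_{\{\hat\lambda_\ell,\gamma_\ell\}_{\ell=1}^L}\ \frac12\sum_{\ell=1}^L\log\frac{\lambda_\ell}{\gamma_\ell}$$ subject to $0<\gamma_\ell\le\lambda_\ell$ and $0\le\hat\lambda_\ell$ for all $\ell$, $\sum_{\ell=1}^L\big(\lambda_\ell-2\sqrt{\hat\lambda_\ell(\lambda_\ell-\gamma_\ell)}+\hat\lambda_\ell\big)\le D$, and $\sum_{\ell=1}^L\big(\sqrt{\lambda_\ell}-\sqrt{\hat\lambda_\ell}\big)^2\le P$.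
   Context: The (information) rate-distortion-perception function is $R(D,P)=\inf I(X;\hat X)$ over conditional distributions $P_{\hat X|X}$, $\hat X\in\mathbb{R}^L$, such that $\mathbb{E}[\|X-\hat X\|^2]\le D$ and $W_2^2(P_X,P_{\hat X})\le P$, where $W_2^2(P_X,P_{\hat X})=\inf\mathbb{E}[\|U-V\|^2]$ over couplings with marginals $P_X$ and $P_{\hat X}$. Logarithms are natural. *)

(* Defs.v *)
From HB Require Import structures.
From mathcomp Require Import all_boot all_order all_algebra.
From mathcomp Require Import all_classical all_reals all_analysis.
From mathcomp Require Import normal_distribution.

Set Implicit Arguments.
Unset Strict Implicit.
Unset Printing Implicit Defensive.

Import Order.TTheory GRing.Theory Num.Theory.
Import numFieldNormedType.Exports.

Local Open Scope classical_set_scope.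
Local Open Scope ring_scope.

Section rdp.
Context {R : realType} {L : nat}.
Local Notation V := (L.-tuple R).

Definition sqdist (u v : V) : R := \sum_(i < L) (tnth u i - tnth v i) ^+ 2.

Definition covmx (Theta : 'M[R]_L) (lam : 'I_L -> R) : 'M[R]_L :=
  Theta^T *m diag_mx (\row_l lam l) *m Theta.

Definition gaussian_law (PX : probability V R) (Sigma : 'M[R]_L) : Prop :=
  forall a : V, (exists i, tnth a i != 0) ->
  forall B : set R, measurable B ->
    PX ((fun x : V => \sum_(i < L) tnth a i * tnth x i) @^-1` B) =
    normal_prob 0 (Num.sqrt (\sum_(i < L) \sum_(j < L)
                               tnth a i * Sigma i j * tnth a j)) B.

Definition is_partition (m : nat) (A : 'I_m -> set V) : Prop :=
  [/\ forall i, measurable (A i),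
      forall i j, i != j -> A i `&` A j = set0 &
      forall x, exists i, A i x].

Definition mi_term (p q r : R) : R :=
  if p == 0 then 0 else p * ln (p / (q * r)).

Local Open Scope ereal_scope.

Definition out_law (PX : probability V R) (k : R.-pker V ~> V) : set V -> \bar R :=
  fun B => \int[PX]_x k x B.

Definition joint_rect (PX : probability V R) (k : R.-pker V ~> V)
  (A B : set V) : \bar R := \int[PX]_(x in A) k x B.

(** mutual information I(X;Xhat) (Dobrushin / Gelfand-Yaglom definition) *)
Definition mutual_info (PX : probability V R) (k : R.-pker V ~> V) : \bar R :=
  ereal_sup [set r | exists (m n : nat) (A : 'I_m -> set V) (B : 'I_n -> set V),
     [/\ is_partition A, is_partition B &
      r = (\sum_(i < m) \sum_(j < n)
            mi_term (fine (joint_rect PX k (A i) (B j))) (fine (PX (A i)))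
                    (fine (out_law PX k (B j))))%R%:E]].

Definition exp_distortion (PX : probability V R) (k : R.-pker V ~> V) : \bar R :=
  \int[PX]_x \int[k x]_y (sqdist x y)%:E.

Definition coupling (mu nu : set V -> \bar R) (g : probability (V * V)%type R) : Prop :=
  (forall A, measurable A -> g (A `*` setT) = mu A) /\
  (forall B, measurable B -> g (setT `*` B) = nu B).

Definition W2sq (mu nu : set V -> \bar R) : \bar R :=
  ereal_inf [set \int[g]_z (sqdist z.1 z.2)%:E | g in coupling mu nu].

Definition RDP (PX : probability V R) (D P : R) : \bar R :=
  ereal_inf [set mutual_info PX k | k in
     [set k : R.-pker V ~> V | exp_distortion PX k <= D%:E /\
                               W2sq PX (out_law PX k) <= P%:E]].

End rdp.

Local Open Scope ring_scope.

Definition rdp_feasible {R : realType} {L : nat} (lam : 'I_L -> R) (D P : R)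
  (lamh gam : 'I_L -> R) : Prop :=
  [/\ forall l, 0 < gam l <= lam l,
      forall l, 0 <= lamh l,
      \sum_(l < L) (lam l - 2 * Num.sqrt (lamh l * (lam l - gam l)) + lamh l) <= D &
      \sum_(l < L) (Num.sqrt (lam l) - Num.sqrt (lamh l)) ^+ 2 <= P].

Definition rdp_objective {R : realType} {L : nat} (lam gam : 'I_L -> R) : R :=
  2^-1 * \sum_(l < L) ln (lam l / gam l).

(* Main.v *)
Require Import Defs.
From HB Require Import structures.
From mathcomp Require Import all_boot all_order all_algebra.
From mathcomp Require Import all_classical all_reals all_analysis.
From mathcomp Require Import measurable_realfun normal_distribution.
From mathcomp Require Import ring lra.
Import Order.TTheory GRing.Theory Num.Theory.
Set Implicit Arguments.
Unset Strict Implicit.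
Unset Printing Implicit Defensive.
Import numFieldNormedType.Exports.
Local Open Scope classical_set_scope.
Local Open Scope ring_scope.

(** Work in the whitened coordinates [u_l(x) = (Theta x)_l / sqrt (lam_l)] of the
    source. The only fact needed about them is that [expR (\sum_l mehler r_l u_l v_l)]
    has mean [1]: a product of Gaussian functions of the coordinates is an average
    of cosines of linear forms, whose means the hypothesis on one-dimensional
    projections provides.

    Converse: given a channel, let [tau_l] be the second moment of the [l]-th rotated
    output coordinate and [rho_l] its correlation with the input coordinate. The
    Donsker-Varadhan bound with the log-density of a Gaussian pair of correlation
    [rho_l] as test function gives
    [I >= - 1/2 \sum_l ln (1 - rho_l^2)], so [lamh = tau] and
    [gam_l = lam_l (1 - rho_l^2)] are feasible; Cauchy-Schwarz handles [W2].

    Achievability: the channel with Mehler density has a deterministic image of the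
    source as output law, so the pair of the source and this image bounds [W2].

    The minimum is attained since the relevant parameters form a compact set. *)

(** * Integrals with a prescribed real value *)

(** [mutual_info] is a supremum over finite partitions, so it is not given as the integral of a
    log-density. Both directions therefore work cell by cell with [1 + x <= expR x]: it bounds a
    cell from above by the integral of the log-density over it, and from below by
    [p g + p - q r expR g]. Summed over cells, the latter is the Donsker-Varadhan functional with
    its logarithm linearised, which loses nothing when the exponential mean of the test function is
    1.

    In the achievability the reference measure is the source law itself: an independent copy of the
    source, reweighted by the Mehler density, has the source law again, and a linear map turns it
    into the output. Outputs with vanishing variances are then no exception.

    Two boundary cases shape the rest. A correlation of modulus 1 has no Mehler density, so the
    converse first tests with [theta * rho], [theta < 1], to see that finite information excludes
    it. Correlation 0 breaks the moment computations for the channel, so the achievability uses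
    slightly larger correlations and lets the loss tend to 0. *)

Section has_integral.
Context d {T : measurableType d} {R : realType}.
Implicit Types (m : {measure set T -> \bar R}) (f g : T -> R) (v w : R).

(** Integrability and value travel together, so that linearity, comparison and limits compose as
    terms without integrability side conditions; values are then identified by
    [has_integral_unique]. *)
Definition has_integral m f v :=
  m.-integrable [set: T] (EFin \o f) /\ \int[m]_x f x = v.

Lemma has_integral_measurable {m f v} :
  has_integral m f v -> measurable_fun [set: T] f.
Proof. by case=> /measurable_int/measurable_EFinP. Qed.

Lemma has_integralE {m f v} : has_integral m f v ->
  (\int[m]_x (f x)%:E = v%:E)%E.
Proof. by case=> fi <-; rewrite fineK//; exact: integrable_fin_num. Qed.

Lemma ge0_has_integral {m f v} : measurable_fun [set: T] f ->
  (forall x, 0 <= f x) -> (\int[m]_x (f x)%:E = v%:E)%E -> has_integral m f v.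
Proof.
move=> mf f0 fv; split; last by rewrite /Rintegral fv.
apply/integrableP; split; first exact/measurable_EFinP.
under eq_integral do rewrite /= ger0_norm//.
by rewrite fv ltry.
Qed.

Lemma has_integral_unique {m f v w} :
  has_integral m f v -> has_integral m f w -> v = w.
Proof. by case=> _ <- [_ <-]. Qed.

Lemma eq_has_integral {m f v} g w : f =1 g -> v = w ->
  has_integral m f v -> has_integral m g w.
Proof. by move=> /funext <- <-. Qed.

Lemma has_integralD {m f v g w} : has_integral m f v -> has_integral m g w ->
  has_integral m (fun x => f x + g x) (v + w).
Proof.
move=> [fi <-] [gi <-]; split; last by rewrite RintegralD.
exact: (integrableD _ fi gi).
Qed.

Lemma has_integralZ {m f v} r : has_integral m f v ->
  has_integral m (fun x => r * f x) (r * v).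
Proof.
move=> [fi <-]; split; last by rewrite RintegralZl.
exact: (integrableZl _ _ fi).
Qed.

Lemma has_integralB {m f v g w} : has_integral m f v -> has_integral m g w ->
  has_integral m (fun x => f x - g x) (v - w).
Proof.
move=> hf /(has_integralZ (- 1)) /(has_integralD hf).
by apply: eq_has_integral => [x|]/=; rewrite mulN1r.
Qed.

Lemma has_integral0 m : has_integral m (fun=> 0) 0.
Proof. by split; [exact: integrable0|rewrite Rintegral_cst// mul0r]. Qed.

Lemma has_integral_sum {m} I (s : seq I) (F : I -> T -> R) (V : I -> R) :
  (forall i, has_integral m (F i) (V i)) ->
  has_integral m (fun x => \sum_(i <- s) F i x) (\sum_(i <- s) V i).
Proof.
move=> hF; elim: s => [|i s ih].
  rewrite big_nil; apply: eq_has_integral (has_integral0 m) => // x.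
  by rewrite big_nil.
rewrite big_cons; apply: eq_has_integral (has_integralD (hF i) ih) => // x.
by rewrite big_cons.
Qed.

Lemma le_has_integral {m f v g w} : has_integral m f v -> has_integral m g w ->
  (forall x, f x <= g x) -> v <= w.
Proof. by move=> [fi <-] [gi <-] fg; exact: le_Rintegral. Qed.

Lemma has_integral_dom {m g w} f : measurable_fun [set: T] f ->
  has_integral m g w -> (forall x, `|f x| <= g x) ->
  has_integral m f (\int[m]_x f x).
Proof.
move=> mf [gi _] fg; split => //; apply: le_integrable gi => //.
  exact/measurable_EFinP.
by move=> x _ /=; rewrite lee_fin (le_trans (fg x))// ler_norm.
Qed.

Lemma has_integral_cvg {m} {f_ : nat -> T -> R} {v_ : nat -> R} {f v g w} :
  (forall n, has_integral m (f_ n) (v_ n)) -> has_integral m f v ->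
  has_integral m g w -> (forall n x, `|f_ n x| <= g x) ->
  (forall x, f_ n x @[n --> \oo] --> f x) -> v_ n @[n --> \oo] --> v.
Proof.
move=> hf_ hf hg fg cf.
rewrite -[v]/(fine v%:E) -(has_integralE hf).
have -> : v_ = fun n => fine (\int[m]_x (f_ n x)%:E)%E.
  by apply/funext => n; rewrite (has_integralE (hf_ n)).
apply: fine_cvg; rewrite fineK ?(has_integralE hf)// -(has_integralE hf).
apply: (@dominated_cvg _ _ _ m setT measurableT (fun n x => (f_ n x)%:E)
  (fun x => (f x)%:E) (fun x => (g x)%:E)).
- by move=> n; apply/measurable_EFinP; exact: has_integral_measurable (hf_ n).
- by move=> x _; exact: cvg_EFin (nearW _ _) (cf x).
- by [].
- by case: hg.
- by move=> n x _; rewrite lee_fin.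
Qed.

End has_integral.

Lemma has_integral_cst d {T : measurableType d} {R : realType}
  (P : probability T R) (r : R) : has_integral P (fun=> r) r.
Proof.
split; first exact: (finite_measure_integrable_cst P r measurableT).
by rewrite Rintegral_cst// [X in fine X]probability_setT mulr1.
Qed.

Lemma bounded_has_integral d {T : measurableType d} {R : realType}
  (P : probability T R) (f : T -> R) (C : R) : measurable_fun [set: T] f ->
  (forall x, `|f x| <= C) -> has_integral P f (\int[P]_x f x).
Proof. by move=> mf fC; exact: has_integral_dom (has_integral_cst P C) fC. Qed.

Lemma cauchy_schwarz_sqr {R : realFieldType} (alpha beta B : R) : 0 <= beta ->
  (forall t, 0 <= alpha - 2 * t * B + t ^+ 2 * beta) -> B ^+ 2 <= alpha * beta.
Proof.
rewrite le_eqVlt => /predU1P[<- h|b0 h].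
  have [->|B0] := eqVneq B 0; first by rewrite expr0n mulr0.
  (* For [beta = 0] the polynomial is affine in [t]; this [t] would give it the value -1 if its
     slope did not vanish. *)
  have := h ((alpha + 1) / (2 * B)).
  have -> : alpha - 2 * ((alpha + 1) / (2 * B)) * B +
    ((alpha + 1) / (2 * B)) ^+ 2 * 0 = -1 by field.
  by rewrite ler0N1.
(* The minimiser of the quadratic. *)
have := h (B / beta).
have -> : alpha - 2 * (B / beta) * B + (B / beta) ^+ 2 * beta =
  (alpha * beta - B ^+ 2) / beta by field; rewrite gt_eqF.
by rewrite pmulr_lge0 ?invr_gt0// subr_ge0.
Qed.

Section second_moments.
Context d {T : measurableType d} {R : realType} (m : {measure set T -> \bar R}).
Variables (f g : T -> R) (alpha beta : R).
Hypotheses (mf : measurable_fun [set: T] f) (mg : measurable_fun [set: T] g).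
Hypotheses (hf : has_integral m (fun x => f x ^+ 2) alpha)
           (hg : has_integral m (fun x => g x ^+ 2) beta).

Lemma has_integralM : has_integral m (fun x => f x * g x) (\int[m]_x (f x * g x)).
Proof.
apply: (has_integral_dom (measurable_funM mf mg) (has_integralD hf hg)) => x.
rewrite ler_norml; have := sqr_ge0 (f x + g x); have := sqr_ge0 (f x - g x).
by rewrite /=; have := sqr_ge0 (f x); have := sqr_ge0 (g x); nra.
Qed.

Lemma cauchy_schwarz B : has_integral m (fun x => f x * g x) B ->
  B ^+ 2 <= alpha * beta.
Proof.
move=> hB; apply: cauchy_schwarz_sqr.
  by apply: (le_has_integral (has_integral0 m) hg) => x; exact: sqr_ge0.
move=> t.
have H := has_integralD (has_integralB hf (has_integralZ (2 * t) hB))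
  (has_integralZ (t ^+ 2) hg).
apply: (le_has_integral (has_integral0 m) H) => x.
by rewrite [leRHS](_ : _ = (f x - t * g x) ^+ 2) ?sqr_ge0//; ring.
Qed.

End second_moments.

(** * Change of measure: mixtures, densities, images, products *)

Section mixture.
Local Open Scope ereal_scope.
Context d1 d2 (X : measurableType d1) (Z : measurableType d2) (R : realType).
Variables (mu : {measure set X -> \bar R}) (kap : X -> {measure set Z -> \bar R}).
Variable (nu : {measure set Z -> \bar R}).
Hypothesis mkap :
  forall U, measurable U -> measurable_fun [set: X] (fun x => kap x U).
Hypothesis nuE : forall U, measurable U -> nu U = \int[mu]_x kap x U.

Import HBNNSimple.

Let ge0_integral_mixture_nnsfun (f : {nnsfun Z >-> R}) :
  \int[nu]_z (f z)%:E = \int[mu]_x (\int[kap x]_z (f z)%:E).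
Proof.
have intE (n : {measure set Z -> \bar R}) : \int[n]_z (f z)%:E =
    \sum_(r \in range f) r%:E * n (f @^-1` [set r]).
  under eq_integral do rewrite fimfunE -fsumEFin//.
  rewrite ge0_integral_fsum//; last 2 first.
    by move=> r; exact/measurable_EFinP/measurableT_comp.
    by move=> r z _; rewrite EFinM nnfun_muleindic_ge0.
  apply: eq_fsbigr => r _.
  rewrite (integralZl_indic _ (fun r => f @^-1` [set r]))//; last first.
    by move=> r0; rewrite preimage_nnfun0.
  by rewrite integral_indic// setIT.
rewrite intE; under [RHS]eq_integral do rewrite intE.
rewrite ge0_integral_fsum//; last 2 first.
  by move=> r; apply: measurable_funeM; exact: mkap.
  move=> r x _; have := mulemu_ge0 (mu := kap x) (fun n => f @^-1` [set n]).
  by apply; exact: preimage_nnfun0.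
apply: eq_fsbigr => r _; rewrite nuE//.
have [r0|r0] := leP 0%R r.
  by rewrite ge0_integralZl//; exact: mkap.
rewrite preimage_nnfun0// !integral0_eq ?mule0// => x _.
  by rewrite measure0 mule0.
Qed.

(** Simple functions first, then monotone limits on both levels. Densities, the channel built from a
    density, and the joint law of a channel are all instances. *)
Lemma ge0_integral_mixture (f : Z -> \bar R) :
  (forall z, 0 <= f z) -> measurable_fun [set: Z] f ->
  \int[nu]_z f z = \int[mu]_x (\int[kap x]_z f z).
Proof.
move=> f0 mf; pose f_ := nnsfun_approx measurableT mf.
have intE (n : {measure set Z -> \bar R}) :
    \int[n]_z f z = limn (fun k => \int[n]_z (f_ k z)%:E).
  rewrite -monotone_convergence//.
  - by apply/eq_integral => z _; apply/esym/cvg_lim => //=; exact: cvg_nnsfun_approx.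
  - by move=> k; exact/measurable_EFinP.
  - by move=> k z _; rewrite lee_fin.
  - by move=> z _ a b ab; rewrite lee_fin; exact/lefP/nd_nnsfun_approx.
rewrite intE; under [RHS]eq_integral do rewrite intE.
rewrite monotone_convergence//.
- by congr (limn _); apply/funext => k; exact: ge0_integral_mixture_nnsfun.
- move=> k; apply: measurable_fun_integral_kernel => //.
    by move=> z; rewrite lee_fin.
  exact/measurable_EFinP.
- by move=> k x _; apply: integral_ge0 => z _; rewrite lee_fin.
- move=> x _ a b ab; apply: ge0_le_integral => //.
  + by move=> z _; rewrite lee_fin.
  + exact/measurable_EFinP.
  + exact/measurable_EFinP.
  + by move=> z _; rewrite lee_fin; exact/lefP/nd_nnsfun_approx.
Qed.

End mixture.

Section density.
Context d (T : measurableType d) (R : realType).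
Variables (mu nu : {measure set T -> \bar R}) (h : T -> R).
Hypotheses (mh : measurable_fun [set: T] h) (h0 : forall x, 0 <= h x).
Hypothesis nuE :
  forall U, measurable U -> (nu U = \int[mu]_(x in U) (h x)%:E)%E.

Lemma ge0_integral_density (f : T -> R) : measurable_fun [set: T] f ->
  (forall x, 0 <= f x) ->
  (\int[nu]_x (f x)%:E = \int[mu]_x (f x * h x)%:E)%E.
Proof.
move=> mf f0.
(* A measure with density [h] is a mixture of point masses of weight [h x]. *)
pose kap x : {measure set T -> \bar R} := mscale (NngNum (h0 x)) (\d_ x).
have kapE x U : (kap x U = (h x)%:E * (\1_U x)%:E)%E.
  by rewrite /kap /mscale/=.
rewrite (@ge0_integral_mixture _ _ _ _ _ mu kap nu); last first.
- exact/measurable_EFinP.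
- by move=> z; rewrite lee_fin.
- move=> U mU; rewrite nuE// integral_mkcond; apply: eq_integral => x _.
  rewrite kapE patchE indicE; case: ifPn => _; first by rewrite mule1.
  by rewrite mule0.
- move=> U mU; under eq_fun do rewrite kapE -EFinM.
  by apply/measurable_EFinP/measurable_funM.
apply: eq_integral => x _.
rewrite /kap ge0_integral_mscale//; last 2 first.
  exact/measurable_EFinP.
  by move=> z _; rewrite lee_fin.
rewrite integral_dirac//; last exact/measurable_EFinP.
by rewrite diracT mul1e mulrC.
Qed.

Lemma has_integral_density (f : T -> R) v : measurable_fun [set: T] f ->
  has_integral mu (fun x => f x * h x) v -> has_integral nu f v.
Proof.
move=> mf [fi fv].
have intf : nu.-integrable [set: T] (EFin \o f).
  apply/integrableP; split; first exact/measurable_EFinP.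
  rewrite (eq_integral (fun x => (`|f x|)%:E))// ge0_integral_density//; last first.
    exact: measurableT_comp.
  move/integrableP: fi => [_]; congr (_ < _)%E; apply: eq_integral => x _ /=.
  by rewrite normrM (ger0_norm (h0 _)).
split => //; rewrite -fv.
have mfp : measurable_fun [set: T] (fun x => f^\+ x) by exact: measurable_funrpos.
have mfn : measurable_fun [set: T] (fun x => f^\- x) by exact: measurable_funrneg.
rewrite /Rintegral integralE [in RHS]integralE.
have posE g : (fun x => (g x)%:E)^\+%E = (fun x : T => (g^\+ x)%:E) :> (T -> \bar R).
  exact: funerpos.
have negE g : (fun x => (g x)%:E)^\-%E = (fun x : T => (g^\- x)%:E) :> (T -> \bar R).
  exact: funerneg.
rewrite !posE !negE !ge0_integral_density//.
congr (fine (_ - _)%E); apply: eq_integral => x _; congr EFin.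
  by rewrite /funrpos maxr_pMl// mul0r.
by rewrite /funrneg maxr_pMl// mul0r mulNr.
Qed.

End density.

Section law.
Context d1 d2 {T1 : measurableType d1} {T2 : measurableType d2} {R : realType}.
Variables (m1 : {measure set T1 -> \bar R}) (m2 : {measure set T2 -> \bar R}).
Variable phi : T1 -> T2.
Hypotheses (mphi : measurable_fun [set: T1] phi)
  (m2E : forall U, measurable U -> m2 U = m1 (phi @^-1` U)).

Lemma ge0_integral_law (f : T2 -> R) : measurable_fun [set: T2] f ->
  (forall y, 0 <= f y) ->
  (\int[m2]_y (f y)%:E = \int[m1]_x (f (phi x))%:E)%E.
Proof.
move=> mf f0; rewrite (eq_measure_integral (pushforward m1 phi)); last first.
  by move=> A mA _; rewrite m2E.
rewrite ge0_integral_pushforward//; first exact/measurable_EFinP.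
by move=> y _; rewrite lee_fin.
Qed.

Lemma has_integral_law (f : T2 -> R) v : has_integral m2 f v ->
  has_integral m1 (fun x => f (phi x)) v.
Proof.
move=> hf; have mf := has_integral_measurable hf.
case: hf => /integrableP[_ fi] <-.
have intf : m1.-integrable [set: T1] (EFin \o (f \o phi)).
  apply/integrableP; split; first exact/measurable_EFinP/measurableT_comp.
  rewrite -(ge0_integral_law (f := fun y => `|f y|))//; exact: measurableT_comp.
split => //; rewrite /Rintegral.
rewrite (eq_measure_integral (m1 := m2) (pushforward m1 phi)); last first.
  by move=> A mA _; rewrite m2E.
by rewrite [in RHS]integral_pushforward//; exact/measurable_EFinP.
Qed.

End law.

Section fubini.
Context d1 d2 {T1 : measurableType d1} {T2 : measurableType d2} {R : realType}.
Variables (P1 : probability T1 R) (P2 : probability T2 R).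
Variables (F : T1 -> T2 -> R).
Hypothesis mF : measurable_fun [set: T1 * T2] (fun z => F z.1 z.2).

Lemma ge0_has_integral_prod2 (H : T2 -> R) v : (forall x y, 0 <= F x y) ->
  (forall y, has_integral P1 (F ^~ y) (H y)) -> has_integral P2 H v ->
  has_integral (P1 \x P2)%E (fun z => F z.1 z.2) v.
Proof.
move=> F0 FH Hv; apply: ge0_has_integral => //.
rewrite (@fubini_tonelli2 _ _ _ _ _ P1 P2 (fun z => (F z.1 z.2)%:E))//; last first.
- by move=> z; rewrite lee_fin.
- exact/measurable_EFinP.
rewrite -(has_integralE Hv); apply: eq_integral => y _.
exact: has_integralE (FH y).
Qed.

Lemma ge0_has_integral_prod1 (G : T1 -> R) v : (forall x y, 0 <= F x y) ->
  (forall x, has_integral P2 (F x) (G x)) -> has_integral P1 G v ->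
  has_integral (P1 \x P2)%E (fun z => F z.1 z.2) v.
Proof.
move=> F0 FG Gv; apply: ge0_has_integral => //.
rewrite (@fubini_tonelli1 _ _ _ _ _ P1 P2 (fun z => (F z.1 z.2)%:E))//; last first.
- by move=> z; rewrite lee_fin.
- exact/measurable_EFinP.
rewrite -(has_integralE Gv); apply: eq_integral => x _.
exact: has_integralE (FG x).
Qed.

Lemma bounded_has_integral_swap (C : R) (G : T1 -> R) (H : T2 -> R) v :
  (forall x y, `|F x y| <= C) ->
  (forall x, has_integral P2 (F x) (G x)) ->
  (forall y, has_integral P1 (F ^~ y) (H y)) ->
  has_integral P2 H v -> has_integral P1 G v.
Proof.
(* Adding the constant [C] reduces to the nonnegative case. *)
move=> FC FG FH Hv.
have G0 x : 0 <= C + G x.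
  apply: (le_has_integral (has_integral0 P2)
    (has_integralD (has_integral_cst P2 C) (FG x))) => y.
  by have := FC x y; rewrite ler_norml => /andP[]; lra.
suff : has_integral P1 (fun x => C + G x) (C + v).
  move=> /has_integralB/(_ (has_integral_cst P1 C)).
  by apply: eq_has_integral => [x|]/=; rewrite addrAC subrr add0r.
have mCF : measurable_fun [set: T1 * T2] (fun z => (C + F z.1 z.2)%:E).
  exact/measurable_EFinP/measurable_funD.
have CF0 z : (0 <= (C + F z.1 z.2)%:E)%E.
  by rewrite lee_fin; have := FC z.1 z.2; rewrite ler_norml => /andP[]; lra.
have GE : (fun x => (C + G x)%:E) =
    fubini_F P2 (fun z => (C + F z.1 z.2)%:E).
  apply/funext => x; rewrite /fubini_F /=.
  by rewrite (has_integralE (has_integralD (has_integral_cst P2 C) (FG x))).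
apply: ge0_has_integral => //.
  apply/measurable_EFinP; rewrite -[EFin \o _]/(fun x => (C + G x)%:E) GE.
  exact: measurable_fun_fubini_tonelli_F.
rewrite GE -fubini_tonelli1// fubini_tonelli2//.
rewrite -(has_integralE (has_integralD (has_integral_cst P2 C) Hv)).
apply: eq_integral => y _; rewrite /fubini_G /=.
by rewrite (has_integralE (has_integralD (has_integral_cst P1 C) (FH y))).
Qed.

End fubini.

(** * Moments of the normal law *)

(* Both sides agree to first order at [s = 0], so the inequality for both signs
   of [s] forces the first-order coefficients to be equal. *)
Lemma eq_of_inv_sqrt_bound (R : realType) (M g eps : R) : 0 < eps ->
  (forall s, `|s| < eps -> 1 - s * M <= (Num.sqrt (1 + 2 * s * g))^-1) -> M = g.
Proof.
move=> eps0 H; apply/eqP/negPn/negP => Mg.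
pose c := g - M; have c0 : 0 < `|c| by rewrite normr_gt0 subr_eq0 eq_sym.
(* For [|s| <= 1], [B] bounds the coefficient of [s^2] in the expansion of
   [(1 - s M)^2 (1 + 2 s g)]. *)
pose B := M ^+ 2 + 4 * `|M * g| + 2 * M ^+ 2 * `|g|.
have B0 : 0 <= B.
  by rewrite /B addr_ge0// ?addr_ge0 ?sqr_ge0//; rewrite mulr_ge0// mulr_ge0 ?sqr_ge0.
near (0 : R)^'+ => t.
have t0 : 0 < t by near: t; exact: nbhs_right_gt.
have te : t < eps by near: t; exact: nbhs_right_lt.
have t1 : t < 1 by near: t; exact: nbhs_right_lt.
have tM : t < (1 + `|M|)^-1.
  by near: t; apply: nbhs_right_lt; rewrite invr_gt0 ltr_pwDl.
have tg : t < (2 * (1 + `|g|))^-1.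
  by near: t; apply: nbhs_right_lt; rewrite invr_gt0 mulr_gt0// ltr_pwDl.
have tB : t < `|c| / (1 + B).
  by near: t; apply: nbhs_right_lt; rewrite divr_gt0// ltr_pwDl.
have {}tM : t * `|M| < 1.
  have M1 : 0 < 1 + `|M| by rewrite ltr_pwDl.
  by move: tM; rewrite -(ltr_pM2r M1) mulVf ?gt_eqF//; nra.
have {}tg : 2 * t * `|g| < 1.
  have g1 : 0 < 2 * (1 + `|g|) by rewrite mulr_gt0// ltr_pwDl.
  by move: tg; rewrite -(ltr_pM2r g1) mulVf ?gt_eqF//; nra.
have {}tB : t * B < `|c|.
  move: tB; rewrite ltr_pdivlMr ?ltr_pwDl//; nra.
(* This sign makes the first-order term [2 s c] equal to [2 t |c|]; it cannot be compensated by
   [t^2 B] once [t B < |c|]. *)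
pose s := t * Num.sg c.
have sgc2 : Num.sg c ^+ 2 = 1 by rewrite sqr_sg -normr_gt0 c0.
have s2 : s ^+ 2 = t ^+ 2 by rewrite exprMn sgc2 mulr1.
have ns : `|s| = t.
  by rewrite normrM (gtr0_norm t0) normr_sg -normr_gt0 c0 mulr1.
have sM : s * M < 1.
  by apply: le_lt_trans (ler_norm _) _; rewrite normrM ns.
have sg1 : 0 < 1 + 2 * s * g.
  have : `|2 * s * g| < 1 by rewrite normrM (normrM 2) ns ger0_norm.
  by rewrite ltr_norml => /andP[]; lra.
have := H s; rewrite ns => /(_ te) {}H.
have : (1 - s * M) ^+ 2 * (1 + 2 * s * g) <= 1.
  rewrite -[leRHS](@mulVf _ (1 + 2 * s * g)) ?gt_eqF// ler_pM2r//.
  rewrite -[X in X^-1](sqr_sqrtr (ltW sg1)) -exprVn.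
  rewrite ler_sqr ?nnegrE ?invr_ge0 ?sqrtr_ge0//.
  by rewrite subr_ge0 ltW.
have -> : (1 - s * M) ^+ 2 * (1 + 2 * s * g) =
  1 + 2 * (s * c) + s ^+ 2 * (M ^+ 2 - 4 * (M * g) + 2 * s * M ^+ 2 * g).
  by rewrite /c; ring.
have -> : s * c = t * `|c| by rewrite /s -mulrA -normrEsg.
have Bs : `|M ^+ 2 - 4 * (M * g) + 2 * s * M ^+ 2 * g| <= B.
  apply: le_trans (ler_normD _ _) _; apply: lerD.
    apply: le_trans (ler_normB _ _) _.
    by rewrite ger0_norm ?sqr_ge0// normrM ger0_norm.
  rewrite (normrM _ g) (normrM _ (M ^+ 2)) (normrM 2 s) ns (ger0_norm (sqr_ge0 M)) (ger0_norm (_ : 0 <= 2))//.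
  by rewrite ler_wpM2r// ler_wpM2r ?sqr_ge0// ger_pMr// ltW.
rewrite s2 => H2.
have : 2 * (t * `|c|) <= t ^+ 2 * B.
  move: Bs; rewrite ler_norml => /andP[Bs _].
  have := ler_wpM2l (sqr_ge0 t) Bs; nra.
by have := mulr_gt0 t0 c0; nra.
Unshelve. all: by end_near. Qed.

Section normal_moments.
Context {R : realType} (s : R).
Hypothesis s0 : 0 < s.
Local Notation leb := (@lebesgue_measure R).
Local Notation g := (normal_pdf 0 s).

Lemma normal_pdf0E x : g x = normal_peak s * expR (- (x ^+ 2 / (2 * s ^+ 2))).
Proof. by rewrite normal_pdfE ?gt_eqF// /normal_fun subr0 mulNr mulr2n mulrDl mul1r. Qed.

Lemma normal_has_integral (f : R -> R) v : measurable_fun [set: R] f ->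
  has_integral leb (fun x => f x * g x) v -> has_integral (normal_prob 0 s) f v.
Proof.
move=> mf; apply: has_integral_density => //.
- exact: measurable_normal_pdf.
- by move=> x; exact: normal_pdf_ge0.
Qed.

Lemma has_integral_normal_pdf : has_integral leb g 1.
Proof.
apply: ge0_has_integral => //; last exact: integral_normal_pdf.
- exact: measurable_normal_pdf.
- by move=> x; exact: normal_pdf_ge0.
Qed.

End normal_moments.

Section normal_second_moment.
Context {R : realType} (s : R).
Hypothesis s0 : 0 < s.
Local Notation leb := (@lebesgue_measure R).

(** The source of all the exponential moments: a Gaussian factor only changes the variance of a
    normal density. Negative [u] above [- 1 / (2 s^2)] are allowed and provide the dominating
    functions. *)
Lemma normal_pdf_rescale u x : 0 < 1 + 2 * u * s ^+ 2 ->
  expR (- (u * x ^+ 2)) * normal_pdf 0 s x =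
  (Num.sqrt (1 + 2 * u * s ^+ 2))^-1 *
    normal_pdf 0 (s / Num.sqrt (1 + 2 * u * s ^+ 2)) x.
Proof.
set k := 1 + 2 * u * s ^+ 2 => k0.
have sk0 : 0 < Num.sqrt k by rewrite sqrtr_gt0.
rewrite !normal_pdf0E// ?divr_gt0//.
rewrite mulrCA -expRD mulrA; congr (_ * expR _); last first.
  rewrite expr_div_n sqr_sqrtr ?ltW// /k; field; rewrite gt_eqF//=.
  by rewrite -/k !gt_eqF.
rewrite /normal_peak expr_div_n sqr_sqrtr ?ltW//.
rewrite -invfM -sqrtrM ?ltW//; congr (Num.sqrt _)^-1.
by field; rewrite gt_eqF.
Qed.

Lemma normal_has_integral_gauss u : 0 < 1 + 2 * u * s ^+ 2 ->
  has_integral (normal_prob 0 s) (fun x => expR (- (u * x ^+ 2)))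
    (Num.sqrt (1 + 2 * u * s ^+ 2))^-1.
Proof.
move=> k0; apply: normal_has_integral => //.
  apply: measurableT_comp => //; apply: measurableT_comp => //.
  by apply: measurable_funM => //; exact: measurable_funX.
have sk0 : 0 < s / Num.sqrt (1 + 2 * u * s ^+ 2) by rewrite divr_gt0// sqrtr_gt0.
have := has_integralZ (Num.sqrt (1 + 2 * u * s ^+ 2))^-1
  (has_integral_normal_pdf (s / Num.sqrt (1 + 2 * u * s ^+ 2))).
apply: eq_has_integral; last by rewrite mulr1.
by move=> x /=; rewrite normal_pdf_rescale.
Qed.

(** Integrating [1 - u x^2 <= expR (- u x^2)] for small [u] of both signs gives exactly the premise
    of [eq_of_inv_sqrt_bound]. *)
Lemma normal_second_moment :
  has_integral (normal_prob 0 s) (fun x => x ^+ 2) (s ^+ 2).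
Proof.
have s20 : 0 < s ^+ 2 by rewrite exprn_gt0.
have m2 : measurable_fun [set: measurableTypeR R] (fun x : R => x ^+ 2).
  by exact: (measurable_funX 2 (@measurable_id _ R setT)).
have hi : has_integral (normal_prob 0 s) (fun x => x ^+ 2)
    (\int[normal_prob 0 s]_x (x ^+ 2)).
  (* At [u = - 1 / (4 s^2)] the rescaling constant is [1/2], so [expR (x^2 / (4 s^2))] is
     integrable, and it dominates [x^2 / (4 s^2)]. *)
  have k0 : 0 < 1 + 2 * - (4 * s ^+ 2)^-1 * s ^+ 2.
    rewrite (_ : 1 + _ = 2^-1) ?invr_gt0//; field; exact: lt0r_neq0.
  have := has_integralZ (4 * s ^+ 2) (normal_has_integral_gauss k0).
  move=> h; apply: (has_integral_dom m2 h) => x.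
  rewrite ger0_norm ?sqr_ge0//.
  rewrite -ler_pdivrMl ?mulr_gt0// mulNr opprK.
  by apply: le_trans (expR_ge1Dx _); lra.
suff : \int[normal_prob 0 s]_x (x ^+ 2) = s ^+ 2 by move=> <-.
apply: (@eq_of_inv_sqrt_bound _ _ _ (2 * s ^+ 2)^-1).
  by rewrite invr_gt0 mulr_gt0.
move=> u; rewrite ltr_norml => /andP[u1 u2].
have k0 : 0 < 1 + 2 * u * s ^+ 2.
  move: u1; rewrite -(ltr_pM2r (_ : 0 < 2 * s ^+ 2)) ?mulr_gt0// mulNr mulVf; last first.
    by rewrite gt_eqF// mulr_gt0.
  lra.
have := has_integralB (has_integral_cst (normal_prob 0 s) 1) (has_integralZ u hi).
move=> /le_has_integral /(_ (normal_has_integral_gauss k0)); apply => x.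
exact: expR_ge1Dx.
Qed.

End normal_second_moment.

Section normal_char.
Context {R : realType} (s : R).
Hypothesis s0 : 0 < s.
Local Notation leb := (@lebesgue_measure R).
Local Notation RR := (measurableTypeR R).
Local Notation g := (normal_pdf 0 s).

Let mg : measurable_fun [set: RR] g. Proof. exact: measurable_normal_pdf. Qed.

Let g0 x : 0 <= g x. Proof. exact: normal_pdf_ge0. Qed.

Let mid : measurable_fun [set: RR] (fun x : RR => x : R).
Proof. exact: (@measurable_id _ R setT). Qed.

Let mcos (t : R) : measurable_fun [set: RR] (fun x : RR => cos (t * x)).
Proof.
apply: measurableT_comp; last exact: measurable_funM.
by apply: continuous_measurable_fun; exact: continuous_cos.
Qed.

Let msin (t : R) : measurable_fun [set: RR] (fun x : RR => sin (t * x)).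
Proof.
apply: measurableT_comp; last exact: measurable_funM.
by apply: continuous_measurable_fun; exact: continuous_sin.
Qed.

Let normr_cos_le1 (x : R) : `|cos x| <= 1.
Proof. by rewrite ler_norml cos_geN1 cos_le1. Qed.

Let normr_sin_le1 (x : R) : `|sin x| <= 1.
Proof. by rewrite ler_norml sin_geN1 sin_le1. Qed.

Let A t := \int[leb]_x (cos (t * x) * g x).

Let hA t : has_integral leb (fun x => cos (t * x) * g x) (A t).
Proof.
apply: (has_integral_dom (measurable_funM (mcos t) mg)
  (has_integral_normal_pdf s)) => x.
by rewrite normrM (ger0_norm (g0 x)) ler_piMl.
Qed.

(** Dominates the derivative in [t] of [cos (t x) g(x)] uniformly in [t]. It follows from
    [|x| <= 1 + x^2], the square being controlled by [expR (x^2 / (4 s^2))]. *)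
Let hxg : has_integral leb (fun x => `|x| * g x) (\int[leb]_x (`|x| * g x)).
Proof.
have m1 : measurable_fun [set: RR] (fun x : RR => `|x| * g x).
  apply: measurable_funM => //; exact: measurableT_comp.
have k0 : 0 < 1 + 2 * - (4 * s ^+ 2)^-1 * s ^+ 2.
  by rewrite (_ : 1 + _ = 2^-1) ?invr_gt0//; field; rewrite gt_eqF.
have h1 := has_integralZ (Num.sqrt (1 + 2 * - (4 * s ^+ 2)^-1 * s ^+ 2))^-1
  (has_integral_normal_pdf
    (s / Num.sqrt (1 + 2 * - (4 * s ^+ 2)^-1 * s ^+ 2))).
have h2 := has_integralD (has_integral_normal_pdf s) (has_integralZ (4 * s ^+ 2) h1).
apply: (has_integral_dom m1 h2) => x.
rewrite -normal_pdf_rescale// normrM normr_id (ger0_norm (g0 x)).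
rewrite mulrA -[X in _ <= X + _]mul1r -mulrDl ler_wpM2r// mulNr opprK.
have s20 : 0 < 4 * s ^+ 2 by rewrite mulr_gt0// exprn_gt0.
have : (4 * s ^+ 2)^-1 * x ^+ 2 <= expR ((4 * s ^+ 2)^-1 * x ^+ 2).
  by apply: le_trans (expR_ge1Dx _); lra.
move=> /(ler_wpM2l (ltW s20)); rewrite mulVKf ?gt_eqF// => h.
rewrite (le_trans _ (lerD (lexx 1) h))//.
by rewrite -real_normK ?num_real//; have := sqr_ge0 (`|x| - 1); nra.
Qed.

Let hsin t : has_integral leb (fun x => x * sin (t * x) * g x)
  (\int[leb]_x (x * sin (t * x) * g x)).
Proof.
apply: (has_integral_dom _ hxg) => [|x].
  by apply: measurable_funM => //; exact: measurable_funM.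
by rewrite !normrM (ger0_norm (g0 x)) ler_wpM2r// ler_piMr.
Qed.

Let is_derive_g (x : R) : is_derive x 1 g (- (x / s ^+ 2) * g x).
Proof.
have -> : g = (fun x => normal_peak s * expR (- (x ^+ 2 / (2 * s ^+ 2)))).
  by apply/funext => y; exact: normal_pdf0E.
apply: is_derive_eq.
rewrite /= !scaler0 !add0r /GRing.scale/=.
by field; rewrite gt_eqF.
Qed.

Let is_derive_lin (t x : R) : is_derive x 1 (fun y : R => t * y) t.
Proof. by apply: is_derive_eq; rewrite /GRing.scale/= mulr1 ?mulr0 ?addr0. Qed.

Let is_derive_F (t x : R) :
  is_derive x 1 (s ^+ 2 *: ((sin \o (fun y : R => t * y)) * g))
    (s ^+ 2 * t * (cos (t * x) * g x) - x * sin (t * x) * g x).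
Proof.
have h1 := is_derive_lin t x; have h2 := is_derive_g x.
have h3 := @is_derive1_comp _ sin (fun y : R => t * y) x _ _
  (is_derive_sin (t * x)) h1.
apply: (@is_derive_eq _ _ _ _ _ _ _ _
  (is_deriveZ (s ^+ 2) (is_deriveM h3 h2))).
rewrite /GRing.scale/=.
by field; rewrite gt_eqF.
Qed.

Let is_derive_A (t : R) : is_derive t 1 A (- \int[leb]_x (x * sin (t * x) * g x)).
Proof.
pose f (t : R) (x : RR) : R := cos (t * x) * g x.
have df (x y : R) : is_derive x 1 (f ^~ y) (- (y * sin (x * y) * g y)).
  have h1 : is_derive x 1 (fun u : R => u * y) y.
    by have := is_derive_lin y x; under eq_fun do rewrite mulrC.
  have h3 := @is_derive1_comp _ cos (fun u : R => u * y) x _ _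
    (is_derive_cos (x * y)) h1.
  apply: (@is_derive_eq _ _ _ _ _ _ _ _ (is_deriveM h3 (is_derive_cst (g y) x 1))).
  by rewrite /GRing.scale/=; ring.
have d1f (x y : R) : partial1of2 f x y = - (y * sin (x * y) * g y).
  by rewrite partial1of2E; exact: (@derive_val _ _ _ _ _ _ _ (df x y)).
have It : `]t - 1, t + 1[%classic t by rewrite /= in_itv/=; apply/andP; split; lra.
have intf x : `]t - 1, t + 1[%classic x -> leb.-integrable [set: RR] (EFin \o f x).
  by move=> _; case: (hA x).
have derf x y : `]t - 1, t + 1[%classic x -> [set: RR] y -> derivable (f ^~ y) x 1.
  by move=> _ _; exact: (@ex_derive _ _ _ _ _ _ _ (df x y)).
have Gub x y : `]t - 1, t + 1[%classic x -> [set: RR] y ->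
    `|partial1of2 f x y| <= `|y| * g y.
  move=> _ _; rewrite d1f normrN !normrM (ger0_norm (g0 y)) ler_wpM2r//.
  by rewrite ler_piMr.
have G0 (y : RR) : 0 <= `|y| * g y by rewrite mulr_ge0.
have dA := derivable_under_integral measurableT It intf derf G0 hxg.1 Gub.
have := differentiation_under_integral measurableT It intf derf G0 hxg.1 Gub.
rewrite derive1E => dA'.
apply: (is_derive_eq (derivableP dA)).
transitivity (\int[leb]_y partial1of2 f t y); first exact: dA'.
apply: (has_integral_unique (m := leb) (f := fun y => partial1of2 f t y)).
  split => //; apply: eq_integrable (has_integralZ (- 1) (hsin t)).1 => // x _.
  by rewrite /= d1f mulN1r.
apply: eq_has_integral (has_integralZ (- 1) (hsin t)) => [x|]; by rewrite ?mulN1r// d1f.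
Qed.

(* Stein's identity: the integral of the derivative of [s^2 sin(t x) g(x)] over
   [-n, n] is a boundary term that vanishes in the limit. *)
Let stein t : \int[leb]_x (x * sin (t * x) * g x) = s ^+ 2 * t * A t.
Proof.
pose F : R -> R := s ^+ 2 *: ((sin \o (fun y : R => t * y)) * g).
pose f x := s ^+ 2 * t * (cos (t * x) * g x) - x * sin (t * x) * g x.
have hf := has_integralB (has_integralZ (s ^+ 2 * t) (hA t)) (hsin t).
pose I n : set RR := `[- n.+1%:R, n.+1%:R]%classic.
have F'f (x : R) : is_derive x 1 F (f x) by exact: is_derive_F.
have cF : continuous F.
  move=> x; apply/differentiable_continuous/derivable1_diffP.
  exact: (@ex_derive _ _ _ _ _ _ _ (F'f x)).
have mI n : measurable (I n) by exact: measurable_itv.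
have cf : continuous f.
  have cg : continuous g.
    move=> x; apply/differentiable_continuous/derivable1_diffP.
    exact: (@ex_derive _ _ _ _ _ _ _ (is_derive_g x)).
  have ct (x : R) : t * y @[y --> x] --> t * x by apply: cvgM; [exact: cvg_cst|exact: cvg_id].
  move=> x; apply: cvgB; apply: cvgM; [exact: cvg_cst| | |exact: cg].
    apply: cvgM; last exact: cg.
    exact: (cvg_comp _ _ (ct x) (@continuous_cos R (t * x))).
  apply: cvgM; first exact: cvg_id.
  exact: (cvg_comp _ _ (ct x) (@continuous_sin R (t * x))).
have i1 n x : \1_(I n) x <= 1 :> R by rewrite indicE lern1 leq_b1.
have FTC n : has_integral leb (fun x => \1_(I n) x * f x)
    (F n.+1%:R - F (- n.+1%:R)).
  have n0 : - n.+1%:R < n.+1%:R :> R by have := ltr0Sn R n; lra.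
  have FTC2 := @continuous_FTC2 _ f F _ _ n0.
  split; last first.
    rewrite -[RHS]/(fine ((F n.+1%:R)%:E - (F (- n.+1%:R))%:E)%E) -FTC2; last 3 first.
    - exact: continuous_subspaceT.
    - split; [|exact: cvg_at_right_filter (cF _)|exact: cvg_at_left_filter (cF _)].
      by move=> x _; exact: (@ex_derive _ _ _ _ _ _ _ (F'f x)).
    - by move=> x _; rewrite derive1E; exact: (@derive_val _ _ _ _ _ _ _ (F'f x)).
    rewrite /Rintegral [in RHS]integral_mkcond; congr fine.
    apply: eq_integral => x _; rewrite patchE indicE.
    by case: ifPn => xI; rewrite ?mul1r ?mul0r.
  apply: le_integrable hf.1 => //.
    by apply/measurable_EFinP/measurable_funM => //; exact: has_integral_measurable hf.
  by move=> x _ /=; rewrite lee_fin normrM ger0_norm// ler_piMl// i1.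
have cvgf : F n.+1%:R - F (- n.+1%:R) @[n --> \oo] -->
    s ^+ 2 * t * A t - \int[leb]_x (x * sin (t * x) * g x).
  have hn : has_integral leb (fun x => `|f x|) (\int[leb]_x `|f x|).
    by split; [exact: integrable_norm hf.1|reflexivity].
  have dom n x : `|\1_(I n) x * f x| <= `|f x|.
    by rewrite normrM ger0_norm// ler_piMl// i1.
  have cvg x : \1_(I n) x * f x @[n --> \oo] --> f x.
    apply: cvg_near_cst; near=> n.
    rewrite indicE mem_set ?mul1r// /I /= in_itv/= -ler_norml.
    rewrite (@le_trans _ _ n%:R) ?ler_nat//.
    by near: n; exact: nbhs_infty_ger.
  exact: (has_integral_cvg FTC hf hn dom cvg).
have FE x : F x = s ^+ 2 * (sin (t * x) * g x) by [].
pose K := normal_peak s * (2 * s ^+ 2).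
have s20 : 0 < s ^+ 2 by rewrite exprn_gt0.
(* Any decay to 0 is enough: [expR (- y) <= 1 / y] at [y = (n+1)^2 / k >= (n+1) / k]. *)
have gK n (x : R) : x ^+ 2 = n.+1%:R ^+ 2 -> g x <= K * harmonic n.
  move=> xn; rewrite normal_pdf0E// xn /K -mulrA ler_wpM2l ?normal_peak_ge0//.
  set k := 2 * s ^+ 2; have k0 : 0 < k by rewrite mulr_gt0.
  have n0 : 0 < n.+1%:R :> R by rewrite ltr0n.
  rewrite expRN /harmonic/= -div1r ler_pdivrMr ?expR_gt0//.
  rewrite -mulrA mulrCA -ler_pdivrMl// mulr1.
  rewrite invrK mulrC -ler_pdivrMr//; apply: le_trans (expR_ge1Dx _).
  have : n.+1%:R / k <= n.+1%:R ^+ 2 / k.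
    by rewrite ler_pM2r ?invr_gt0// expr2 ler_peMl ?ler1n// ltW.
  lra.
have FK n (x : R) : x ^+ 2 = n.+1%:R ^+ 2 -> `|F x| <= s ^+ 2 * K * harmonic n.
  move=> xn; rewrite FE normrM (gtr0_norm s20) -mulrA ler_pM2l//.
  rewrite normrM (ger0_norm (g0 x)) (le_trans _ (gK n x xn))//.
  by rewrite ler_piMl.
have cvg0 : F n.+1%:R - F (- n.+1%:R) @[n --> \oo] --> (0 : R).
  apply: norm_cvg0.
  have cK : 2 * (s ^+ 2 * K) * harmonic n @[n --> \oo] --> 2 * (s ^+ 2 * K) * (0 : R).
    by apply: cvgM; [exact: cvg_cst|exact: cvg_harmonic].
  rewrite mulr0 in cK.
  apply: squeeze_cvgr (cvg_cst (0 : R)) cK; apply: nearW => n; rewrite normr_ge0/=.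
  rewrite (le_trans (ler_normB _ _))//.
  rewrite -mulrA mulr_natl mulr2n lerD// FK ?sqrrN//.
by apply/esym/eqP; rewrite -subr_eq0; apply/eqP; exact: (cvg_unique _ cvgf cvg0).
Unshelve. all: by end_near. Qed.

Let A0 : A 0 = 1.
Proof.
have := has_integral_normal_pdf s; apply: has_integral_unique.
by apply: eq_has_integral (hA 0) => // x; rewrite mul0r cos0 mul1r.
Qed.

(** Stein's identity makes the transform a solution of [A' = - s^2 t A] with [A 0 = 1], so its
    product with [expR (s^2 t^2 / 2)] has zero derivative. *)
Lemma normal_pdf_cos t : has_integral leb (fun x => cos (t * x) * g x)
  (expR (- (s ^+ 2 * t ^+ 2 / 2))).
Proof.
suff <- : A t = expR (- (s ^+ 2 * t ^+ 2 / 2)) by exact: hA.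
pose E (t : R) := expR (s ^+ 2 * t ^+ 2 / 2).
have dE (x : R) : is_derive x 1 E (s ^+ 2 * x * E x).
  have h1 : is_derive x 1 (fun u : R => s ^+ 2 * u ^+ 2 / 2) (s ^+ 2 * x).
    apply: is_derive_eq.
    by rewrite /= ?scaler0 ?addr0 ?add0r /GRing.scale/=; field.
  apply: (@is_derive_eq _ _ _ _ _ _ _ _
    (@is_derive1_comp _ expR _ x _ _ (is_derive_expR (s ^+ 2 * x ^+ 2 / 2)) h1)).
  by rewrite mulrC.
have cst : A t * E t = A 0 * E 0.
  apply: (@is_derive_0_is_cst _ (A * E)) => x.
  have h1 := is_derive_A x; rewrite stein in h1.
  apply: (@is_derive_eq _ _ _ _ _ _ _ _ (is_deriveM h1 (dE x))).
  by rewrite /GRing.scale/=; ring.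
move: cst; rewrite A0 mul1r {2}/E expr0n mulr0 mul0r expR0.
rewrite expRN /E => /(congr1 (fun z => z / E t)).
by rewrite mulfK ?gt_eqF ?expR_gt0// div1r.
Qed.

Lemma normal_cos t : has_integral (normal_prob 0 s) (fun x => cos (t * x))
  (expR (- (s ^+ 2 * t ^+ 2 / 2))).
Proof.
by apply: normal_has_integral (normal_pdf_cos t) => //; exact: mcos.
Qed.

End normal_char.

(** * Standard Gaussian families *)

(** The Gaussian factor replaces the variance 1 by [1 / (1 + 2 d)], for which the cosine transform
    is known. It serves to integrate out the auxiliary normal variable attached to one
    coordinate. *)
Lemma normal_gauss_cos {R : realType} (d t : R) : 0 <= d ->
  has_integral (normal_prob 0 1) (fun x => expR (- (d * x ^+ 2)) * cos (t * x))
    ((Num.sqrt (1 + 2 * d))^-1 * expR (- (t ^+ 2 / (2 * (1 + 2 * d))))).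
Proof.
move=> d0.
have d1 : 0 < 1 + 2 * d by rewrite ltr_pwDl// mulr_ge0.
have k0 : 0 < 1 + 2 * d * 1 ^+ 2 by rewrite expr1n mulr1.
have s0 : 0 < (1 : R) / Num.sqrt (1 + 2 * d * 1 ^+ 2).
  by rewrite divr_gt0// sqrtr_gt0.
have mid : measurable_fun [set: measurableTypeR R]
    (fun x : measurableTypeR R => x : R) by exact: (@measurable_id _ R setT).
apply: normal_has_integral => //.
  apply: measurable_funM.
    apply: measurableT_comp => //; apply: measurableT_comp => //.
    by apply: measurable_funM => //; exact: measurable_funX.
  apply: measurableT_comp; last exact: measurable_funM.
  by apply: continuous_measurable_fun; exact: continuous_cos.
apply: eq_has_integral (has_integralZ (Num.sqrt (1 + 2 * d * 1 ^+ 2))^-1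
  (normal_pdf_cos s0 t)) => [x|].
  by rewrite mulrCA -normal_pdf_rescale// mulrCA mulrA.
rewrite expr1n !mulr1 mul1r exprVn sqr_sqrtr ?ltW//; congr (_ * expR _).
by field; rewrite gt_eqF.
Qed.

Lemma cosM {R : realType} (x y : R) :
  cos x * cos y = 2^-1 * (cos (y + x) + cos (y - x)).
Proof. by rewrite cosD cosB; field. Qed.

Section standard_gaussian.
Context d {T : measurableType d} {R : realType} (P : probability T R).
Context {n : nat} (u : 'I_n -> T -> R).

(** The characteristic function of a standard normal vector without complex numbers: the free phase
    [b] covers the real and the imaginary part, and it absorbs the shifts produced when factors
    [expR (- d (u - m)^2)] are expanded into cosines. *)
Definition standard_gaussian := (forall l, measurable_fun [set: T] (u l)) /\
  forall (a : 'I_n -> R) b,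
    has_integral P (fun x => cos (\sum_l a l * u l x - b))
      (cos b * expR (- (\sum_l a l ^+ 2 / 2))).

Hypothesis gu : standard_gaussian.

Let mu l : measurable_fun [set: T] (u l). Proof. exact: gu.1. Qed.

Let mcos a b : measurable_fun [set: T] (fun x => cos (\sum_l a l * u l x - b)).
Proof. exact: has_integral_measurable (gu.2 a b). Qed.

Section product.
Variables (dd m : 'I_n -> R).
Hypothesis dd0 : forall l, 0 <= dd l.
Let E l x := expR (- (dd l * (u l x - m l) ^+ 2)).
Let c l := (Num.sqrt (1 + 2 * dd l))^-1 * expR (- (dd l * m l ^+ 2 / (1 + 2 * dd l))).

Let mE l : measurable_fun [set: T] (E l).
Proof.
apply: measurableT_comp => //; apply: measurableT_comp => //.
apply: measurable_funM => //; apply: measurable_funX.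
exact: measurable_funB.
Qed.

Let mprod r : measurable_fun [set: T] (fun x => \prod_(l <- r) E l x).
Proof. by apply: measurable_prod => l _; exact: mE. Qed.

Let E01 l x : 0 <= E l x <= 1.
Proof.
rewrite expR_ge0 /E -[leRHS]expR0 ler_expR oppr_le0 mulr_ge0//.
exact: sqr_ge0.
Qed.

Let prod01 r x : 0 <= \prod_(l <- r) E l x <= 1.
Proof.
apply: (big_ind (fun p => 0 <= p <= 1)) => // [|p q /andP[p0 p1] /andP[q0 q1]].
  by rewrite ler01 lexx.
by rewrite mulr_ge0//= mulr_ile1.
Qed.

(* Each factor [exp (- d (u - m)^2)] is an average of cosines
   [cos (w g (u - m))], [w^2 = 2 d], over a standard normal [g]; the product of
   two cosines being a sum of cosines, the factors can be integrated out one at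
   a time. *)
Let has_integral_prod_cos r : uniq r -> forall (a : 'I_n -> R) b,
  (forall l, l \in r -> a l = 0) ->
  has_integral P
    (fun x => \prod_(l <- r) E l x * cos (\sum_l a l * u l x - b))
    (\prod_(l <- r) c l * (cos b * expR (- (\sum_l a l ^+ 2 / 2)))).
Proof.
elim: r => [_ a b _|l r ih /= /andP[lr ur] a b a0].
  rewrite big_nil mul1r; apply: eq_has_integral (gu.2 a b) => // x.
  by rewrite big_nil mul1r.
pose w := Num.sqrt (2 * dd l).
have w2 : w ^+ 2 = 2 * dd l by rewrite sqr_sqrtr// mulr_ge0.
have al0 : a l = 0 by rewrite a0// mem_head.
have ar0 j : j \in r -> a j = 0 by move=> jr; rewrite a0// in_cons jr orbT.
pose N : probability (measurableTypeR R) R := normal_prob 0 1.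
pose rest x := \prod_(l <- r) E l x * cos (\sum_l a l * u l x - b).
pose F x (g : measurableTypeR R) : R := cos (w * (u l x - m l) * g) * rest x.
have mrest : measurable_fun [set: T] rest by exact: measurable_funM.
have mF : measurable_fun [set: T * measurableTypeR R] (fun z => F z.1 z.2).
  apply: measurable_funM; last exact: measurableT_comp.
  apply: measurableT_comp.
    by apply: continuous_measurable_fun; exact: continuous_cos.
  apply: measurable_funM; last first.
    exact: (@measurable_snd _ _ T (measurableTypeR R)).
  apply: measurable_funM => //; apply: measurable_funB => //.
  exact: measurableT_comp.
have FC x g : `|F x g| <= 1.
  rewrite normrM mulr_ile1// ?ler_norml ?cos_geN1 ?cos_le1//.
  rewrite -ler_norml normrM mulr_ile1// ?ler_norml ?cos_geN1 ?cos_le1//.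
  have /andP[p0 ->] := prod01 r x; rewrite andbT.
  by rewrite (le_trans _ p0)// lerN10.
have FG x : has_integral N (F x) (\prod_(l <- l :: r) E l x *
    cos (\sum_l a l * u l x - b)).
  have := has_integralZ (rest x) (normal_cos (ltr01 : 0 < (1 : R)) (w * (u l x - m l))).
  apply: eq_has_integral => [g|]; first by rewrite /F mulrC.
  rewrite [LHS]mulrC big_cons -[RHS]mulrA; congr (_ * _).
  by rewrite /E; congr expR; rewrite exprMn w2; field.
pose H (g : R) := \prod_(l <- r) c l * cos b * expR (- (\sum_l a l ^+ 2 / 2)) *
  (expR (- (dd l * g ^+ 2)) * cos (w * m l * g)).
have FH g : has_integral P (F ^~ g) (H g).
  (* The product of two cosines is a sum over [e = 1] and [e = -1]. The new frequency [e w g] goes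
     to coordinate [l], which is free because [a l = 0]; the shift by [m l] goes into the phase. *)
  pose ap e (j : 'I_n) := if j == l then e * (w * g) else a j.
  have apE e x : \sum_j ap e j * u j x = \sum_j a j * u j x + e * (w * g) * u l x.
    rewrite (bigD1 l)//= [in RHS](bigD1 l)//= al0 mul0r add0r /ap eqxx addrC.
    by congr (_ + _); apply: eq_bigr => j /negPf ->.
  have ap2 e : e ^+ 2 = 1 ->
      \sum_j ap e j ^+ 2 / 2 = \sum_j a j ^+ 2 / 2 + dd l * g ^+ 2.
    move=> e2; rewrite (bigD1 l)//= [in RHS](bigD1 l)//= al0 expr0n mul0r add0r.
    rewrite /ap eqxx addrC !exprMn e2 w2; congr (_ + _); last by field.
    by apply: eq_bigr => j /negPf ->.
  have ap0 e j : j \in r -> ap e j = 0.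
    by move=> jr; rewrite /ap; case: eqP => [jl|_]; [rewrite -jl jr in lr|exact: ar0].
  have h1 := ih ur (ap 1) (b + w * g * m l) (ap0 1).
  have h2 := ih ur (ap (- 1)) (b - w * g * m l) (ap0 (- 1)).
  apply: eq_has_integral (has_integralZ 2^-1 (has_integralD h1 h2)) => [x|].
    rewrite /F /rest [RHS]mulrCA cosM !apE -mulrDr [LHS]mulrCA.
    by congr (_ * (_ * (cos _ + cos _))); ring.
  rewrite !ap2 ?sqrrN ?expr1n// opprD expRD /H cosD cosB.
  have -> : w * g * m l = w * m l * g by ring.
  by field.
apply: (bounded_has_integral_swap mF FC FG FH (P2 := N)).
have := normal_gauss_cos (w * m l) (dd0 l).
move=> /(has_integralZ (\prod_(l <- r) c l * cos b * expR (- (\sum_l a l ^+ 2 / 2)))).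
apply: eq_has_integral => //.
rewrite big_cons /c exprMn w2.
have -> : 2 * dd l * m l ^+ 2 / (2 * (1 + 2 * dd l)) =
    dd l * m l ^+ 2 / (1 + 2 * dd l).
  by field; rewrite gt_eqF// ltr_pwDl// mulr_ge0.
by ring.
Qed.

Lemma has_integral_prod_gauss :
  has_integral P (fun x => \prod_l expR (- (dd l * (u l x - m l) ^+ 2)))
  (\prod_l ((Num.sqrt (1 + 2 * dd l))^-1 *
    expR (- (dd l * m l ^+ 2 / (1 + 2 * dd l))))).
Proof.
have := has_integral_prod_cos (index_enum_uniq 'I_n) 0 (fun l _ => erefl 0).
have s0 (f : 'I_n -> R) : \sum_l (fun=> 0) l * f l = 0 :> R.
  by rewrite big1// => l _; rewrite mul0r.
apply: eq_has_integral => [x|].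
  by rewrite (s0 (fun l => u l x)) subr0 cos0 mulr1.
rewrite cos0 mul1r [X in expR (- X)]big1 ?oppr0 ?expR0 ?mulr1// => l _.
by rewrite expr0n mul0r.
Qed.

End product.

(** Up to the constant [sqrt (g l)], each factor is the density of a normal law of mean [p l] and
    variance [g l] relative to the standard one. Completing the square turns it into a multiple of
    [expR (- d (u - m)^2)] with [d >= 0]; for [g l = 1] the exponent is affine, which has this form
    only when [p l = 0]. *)
Lemma has_integral_tilt (p g : 'I_n -> R) :
  (forall l, 0 < g l <= 1) -> (forall l, g l = 1 -> p l = 0) ->
  has_integral P
    (fun x => expR (\sum_l (u l x ^+ 2 / 2 - (u l x - p l) ^+ 2 / (2 * g l))))
    (\prod_l Num.sqrt (g l)).
Proof.
move=> g01 p0.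
pose dd l := (1 - g l) / (2 * g l).
pose m l := p l / (1 - g l).
have dd0 l : 0 <= dd l.
  by have /andP[g0 g1] := g01 l; rewrite divr_ge0 ?subr_ge0// mulr_ge0// ltW.
have := has_integral_prod_gauss m dd0.
move=> /(has_integralZ (\prod_l expR (dd l * m l ^+ 2 - p l ^+ 2 / (2 * g l)))).
apply: eq_has_integral => [x|].
  rewrite -big_split/= expR_sum; apply: eq_bigr => l _; rewrite -expRD; congr expR.
  have /andP[g0 g1] := g01 l; rewrite /dd /m.
  have [gl1|gl1] := eqVneq (g l) 1; first by rewrite gl1 p0// subrr !mul0r expr0n/= !mul0r; field.
  have g1N0 : 1 - g l != 0 by rewrite subr_eq0 eq_sym.
  by field; rewrite ?g1N0 ?(gt_eqF g0).
rewrite -big_split/=; apply: eq_bigr => l _.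
have /andP[g0 g1] := g01 l.
have -> : 1 + 2 * dd l = (g l)^-1 by rewrite /dd; field; rewrite gt_eqF.
rewrite sqrtrV ?ltW// invrK mulrCA -expRD [X in expR X](_ : _ = 0) ?expR0 ?mulr1//.
rewrite invrK /dd /m.
have [gl1|gl1] := eqVneq (g l) 1; first by rewrite gl1 p0// subrr !mul0r expr0n/= !mul0r; field.
have g1N0 : 1 - g l != 0 by rewrite subr_eq0 eq_sym.
by field; rewrite ?g1N0 ?(gt_eqF g0).
Qed.

(** A further factor [expR (- s (u - p)^2)] only replaces [g l] by [g l / (1 + 2 s g l)], so the
    variance is read off from the dependence on [s] as for [normal_second_moment]. *)
Lemma has_integral_tilt_sqr (p g : 'I_n -> R) l : (forall l, 0 < g l < 1) ->
  has_integral P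
    (fun x => (u l x - p l) ^+ 2 *
      expR (\sum_l (u l x ^+ 2 / 2 - (u l x - p l) ^+ 2 / (2 * g l))))
    (g l * \prod_l Num.sqrt (g l)).
Proof.
move=> g01.
have g0 j : 0 < g j by have /andP[] := g01 j.
pose W x := expR (\sum_l (u l x ^+ 2 / 2 - (u l x - p l) ^+ 2 / (2 * g l))).
have hW : has_integral P W (\prod_l Num.sqrt (g l)).
  apply: has_integral_tilt => j; have /andP[j0 j1] := g01 j; first by rewrite j0 ltW.
  by move=> gj1; rewrite gj1 ltxx in j1.
(* The condition [- eps < s] says exactly that the modified variance [g l / (1 + 2 s g l)] stays
   below 1; negative [s] are available because [g l < 1]. *)
pose eps := (1 - g l) / (2 * g l).
have eps0 : 0 < eps.
  by have /andP[j0 j1] := g01 l; rewrite divr_gt0 ?subr_gt0// mulr_gt0.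
have hs s : - eps < s -> has_integral P
    (fun x => expR (- (s * (u l x - p l) ^+ 2)) * W x)
    ((Num.sqrt (1 + 2 * s * g l))^-1 * \prod_l Num.sqrt (g l)).
  move=> es.
  have k1 : g l < 1 + 2 * s * g l.
    move: es; rewrite -(ltr_pM2r (_ : 0 < 2 * g l)) ?mulr_gt0//.
    by rewrite mulNr /eps divfK ?gt_eqF ?mulr_gt0//; lra.
  have k0 : 0 < 1 + 2 * s * g l by exact: lt_trans k1.
  pose g' j := if j == l then g l / (1 + 2 * s * g l) else g j.
  have g'01 j : 0 < g' j < 1.
    by rewrite /g'; case: eqP => // _; rewrite divr_gt0//= ltr_pdivrMr// mul1r.
  have : has_integral P
    (fun x => expR (\sum_l (u l x ^+ 2 / 2 - (u l x - p l) ^+ 2 / (2 * g' l))))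
    (\prod_l Num.sqrt (g' l)).
    apply: has_integral_tilt => j; have /andP[j0 j1] := g'01 j; first by rewrite j0 ltW.
    by move=> gj1; rewrite gj1 ltxx in j1.
  apply: eq_has_integral => [x|].
    rewrite /W -expRD; congr expR.
    rewrite (bigD1 l)//= [in RHS](bigD1 l)//= addrA; congr (_ + _); last first.
      by apply: eq_bigr => j /negPf jl; rewrite /g' jl.
    by rewrite /g' eqxx; field; rewrite !gt_eqF.
  rewrite (bigD1 l)//= [in RHS](bigD1 l)//= mulrA; congr (_ * _); last first.
    by apply: eq_bigr => j /negPf jl; rewrite /g' jl.
  by rewrite /g' eqxx sqrtrM ?ltW// sqrtrV ?ltW// mulrC.
pose Q := \prod_l Num.sqrt (g l).
have Q0 : 0 < Q by apply: prodr_gt0 => j _; rewrite sqrtr_gt0.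
have mS : measurable_fun [set: T] (fun x => (u l x - p l) ^+ 2 * W x).
  apply: measurable_funM; last exact: has_integral_measurable hW.
  by apply: measurable_funX; exact: measurable_funB.
have hi : has_integral P (fun x => (u l x - p l) ^+ 2 * W x)
    (\int[P]_x ((u l x - p l) ^+ 2 * W x)).
  have e2 : - eps < - (eps / 2) by lra.
  apply: (has_integral_dom mS (has_integralZ (eps / 2)^-1 (hs _ e2))) => x.
  rewrite ger0_norm; last by rewrite mulr_ge0 ?sqr_ge0 ?expR_ge0.
  rewrite mulrA ler_wpM2r ?expR_ge0//.
  have e20 : 0 < eps / 2 by lra.
  rewrite ler_pdivlMl// mulNr opprK.
  by apply: le_trans (expR_ge1Dx _); lra.
suff hQ : \int[P]_x ((u l x - p l) ^+ 2 * W x) / Q = g l.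
  by apply: eq_has_integral hi => //; rewrite -hQ divfK ?gt_eqF.
apply: (eq_of_inv_sqrt_bound eps0) => s; rewrite ltr_norml => /andP[s1 s2].
have := has_integralB hW (has_integralZ s hi).
move=> /le_has_integral /(_ (hs _ s1)) h.
have {}h : Q - s * (\int[P]_x ((u l x - p l) ^+ 2 * W x)) <=
    (Num.sqrt (1 + 2 * s * g l))^-1 * Q.
  apply: h => x; rewrite mulrA -[X in X - _]mul1r -mulrBl ler_wpM2r ?expR_ge0//.
  exact: expR_ge1Dx.
rewrite -(ler_pM2r Q0); apply: le_trans h.
by rewrite mulrBl mul1r -mulrA divfK// gt_eqF.
Qed.

End standard_gaussian.

(** * The Mehler density and whitened coordinates *)

(* [mehler r u v] is the logarithm of the density of a centred Gaussian pair with
   unit variances and correlation [r] with respect to two independent standard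
   normals. *)
Definition mehler {R : realType} (r u v : R) : R :=
  u ^+ 2 / 2 - (u - r * v) ^+ 2 / (2 * (1 - r ^+ 2)) - ln (1 - r ^+ 2) / 2.

Lemma subr1_sqr_gt0 {R : realDomainType} (r : R) : `|r| < 1 -> 0 < 1 - r ^+ 2.
Proof. by rewrite ltr_norml => /andP[]; nra. Qed.

Lemma mehlerC {R : realType} (r u v : R) : `|r| < 1 ->
  mehler r u v = mehler r v u.
Proof.
by move=> /subr1_sqr_gt0 r1; rewrite /mehler; field; rewrite gt_eqF.
Qed.

Lemma measurable_mehler d (T : measurableType d) {R : realType} (r : R) (f g : T -> R) :
  measurable_fun [set: T] f -> measurable_fun [set: T] g ->
  measurable_fun [set: T] (fun x => mehler r (f x) (g x)).
Proof.
move=> mf mg; apply: measurable_funB => //.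
apply: measurable_funB; apply: measurable_funM => //; apply: measurable_funX => //.
by apply: measurable_funB => //; exact: measurable_funM.
Qed.

Section mehler_integral.
Context d {T : measurableType d} {R : realType} (P : probability T R).
Context {n : nat} (u : 'I_n -> T -> R).
Hypothesis gu : standard_gaussian P u.

Let expR_mehler (r v : 'I_n -> R) x :
  expR (\sum_l mehler (r l) (u l x) (v l)) =
  expR (- \sum_l ln (1 - r l ^+ 2) / 2) *
  expR (\sum_l (u l x ^+ 2 / 2 -
    (u l x - r l * v l) ^+ 2 / (2 * (1 - r l ^+ 2)))).
Proof. by rewrite -expRD addrC -sumrB. Qed.

Let expR_ln_sqrt (r : 'I_n -> R) : (forall l, `|r l| < 1) ->
  expR (- \sum_l ln (1 - r l ^+ 2) / 2) * \prod_l Num.sqrt (1 - r l ^+ 2) = 1.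
Proof.
move=> r1; rewrite -sumrN expR_sum -big_split/= big1// => l _.
have /subr1_sqr_gt0 g0 := r1 l.
have -> : 1 - r l ^+ 2 = expR (ln (1 - r l ^+ 2) / 2) ^+ 2.
  by rewrite [RHS]expr2 -expRD -splitr lnK.
rewrite sqrtr_sqr ger0_norm ?expR_ge0// lnXn ?expR_gt0// expRK mulr2n -splitr.
by rewrite expRN mulVf// gt_eqF ?expR_gt0.
Qed.

(** For fixed [v] this is the conditional density of the first coordinates: mean [r v], variance
    [1 - r^2]. Variance 1 means [r = 0], where the mean vanishes as [has_integral_tilt] requires. *)
Lemma has_integral_mehler (r v : 'I_n -> R) : (forall l, `|r l| < 1) ->
  has_integral P (fun x => expR (\sum_l mehler (r l) (u l x) (v l))) 1.
Proof.
move=> r1.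
have : has_integral P (fun x => expR (\sum_l (u l x ^+ 2 / 2 -
    (u l x - r l * v l) ^+ 2 / (2 * (1 - r l ^+ 2)))))
    (\prod_l Num.sqrt (1 - r l ^+ 2)).
  apply: (has_integral_tilt gu (p := fun l => r l * v l)
    (g := fun l => 1 - r l ^+ 2)) => l.
    by rewrite subr1_sqr_gt0// gerBl sqr_ge0.
  move=> /eqP; rewrite subr_eq -subr_eq0 opprD addNKr oppr_eq0 sqrf_eq0 => /eqP ->.
  by rewrite mul0r.
move=> /(has_integralZ (expR (- \sum_l ln (1 - r l ^+ 2) / 2))).
by apply: eq_has_integral => [x|]; [rewrite expR_mehler|exact: expR_ln_sqrt].
Qed.

(** The conditional variance. Here [r l] stays away from 0 so that the variance is below 1 and can
    be perturbed in both directions. *)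
Lemma has_integral_mehler_sqr (r v : 'I_n -> R) l : (forall l, 0 < r l < 1) ->
  has_integral P (fun x => (u l x - r l * v l) ^+ 2 *
    expR (\sum_l mehler (r l) (u l x) (v l))) (1 - r l ^+ 2).
Proof.
move=> r1.
have : has_integral P (fun x => (u l x - r l * v l) ^+ 2 *
    expR (\sum_l (u l x ^+ 2 / 2 -
      (u l x - r l * v l) ^+ 2 / (2 * (1 - r l ^+ 2)))))
    ((1 - r l ^+ 2) * \prod_l Num.sqrt (1 - r l ^+ 2)).
  apply: (@has_integral_tilt_sqr _ _ _ _ _ _ gu (fun l => r l * v l)
    (fun l => 1 - r l ^+ 2)) => j.
  by have /andP[] := r1 j; nra.
move=> /(has_integralZ (expR (- \sum_l ln (1 - r l ^+ 2) / 2))).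
apply: eq_has_integral => [x|]; first by rewrite expR_mehler mulrCA.
rewrite mulrCA expR_ln_sqrt ?mulr1// => j.
by have /andP[r0 ?] := r1 j; rewrite gtr0_norm.
Qed.

End mehler_integral.

(** * Rotated and whitened coordinates *)

Lemma sqdist_ge0 {R : realType} {L : nat} (x y : L.-tuple R) : 0 <= sqdist x y.
Proof. by apply: sumr_ge0 => i _; exact: sqr_ge0. Qed.

Lemma measurable_sqdist {R : realType} {L : nat} :
  measurable_fun [set: L.-tuple R * L.-tuple R] (fun z => sqdist z.1 z.2).
Proof.
apply: measurable_sum => i; apply: measurable_funX; apply: measurable_funB.
  exact: measurableT_comp (measurable_tnth i) measurable_fst.
exact: measurableT_comp (measurable_tnth i) measurable_snd.
Qed.

Section rotation.
Context {R : realType} {L : nat} (Theta : 'M[R]_L).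
Hypothesis ThetaK : Theta^T *m Theta = 1%:M.
Local Notation V := (L.-tuple R).

Definition rot (x : V) (l : 'I_L) : R := \sum_i Theta l i * tnth x i.

Definition unrot (z : 'I_L -> R) : V := [tuple \sum_l Theta l i * z l | i < L].

Lemma unrotK z l : rot (unrot z) l = z l.
Proof.
rewrite /rot; under eq_bigr do rewrite tnth_mktuple big_distrr/=.
rewrite exchange_big/= (bigD1 l)//= [X in _ + X]big1 ?addr0 => [|j jl].
  have := congr1 (fun M : matrix R L L => M l l) (mulmx1C ThetaK).
  rewrite !mxE eqxx => h; rewrite -[RHS]mul1r -[X in _ = X * _]h big_distrl/=.
  by apply: eq_bigr => i _; rewrite !mxE mulrA.
have := congr1 (fun M : matrix R L L => M l j) (mulmx1C ThetaK).
rewrite !mxE eq_sym (negPf jl) => h; rewrite -[RHS](mul0r (z j)) -[X in _ = X * _]h big_distrl/=.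
by apply: eq_bigr => i _; rewrite !mxE mulrA.
Qed.

Lemma sqdist_rot (x y : V) : sqdist x y = \sum_l (rot x l - rot y l) ^+ 2.
Proof.
pose w : 'cV[R]_L := \col_i (tnth x i - tnth y i).
have wE l : (Theta *m w) l 0 = rot x l - rot y l.
  by rewrite mxE /rot -sumrB; apply: eq_bigr => i _; rewrite mxE mulrBr.
have sq (v : 'cV[R]_L) : (v^T *m v) 0 0 = \sum_l v l 0 ^+ 2.
  by rewrite mxE; apply: eq_bigr => l _; rewrite mxE expr2.
rewrite /sqdist; transitivity ((w^T *m w) 0 0).
  by rewrite sq; apply: eq_bigr => i _; rewrite mxE.
transitivity (((Theta *m w)^T *m (Theta *m w)) 0 0).
  by rewrite trmx_mul mulmxA -(mulmxA w^T) ThetaK mulmx1.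
by rewrite sq; apply: eq_bigr => l _; rewrite wE.
Qed.

Lemma measurable_rot l : measurable_fun [set: V] (rot ^~ l).
Proof.
apply: measurable_sum => i; apply: measurable_funM => //.
exact: measurable_tnth.
Qed.

Lemma measurable_unrot d (T : measurableType d) (f : T -> 'I_L -> R) :
  (forall l, measurable_fun [set: T] (f ^~ l)) ->
  measurable_fun [set: T] (fun x => unrot (f x)).
Proof.
move=> mf; apply/measurable_fun_tnthP => i.
rewrite (_ : _ \o _ = fun x => \sum_l Theta l i * f x l); last first.
  by apply/funext => x /=; rewrite tnth_mktuple.
by apply: measurable_sum => l; exact: measurable_funM.
Qed.

End rotation.

Section gaussian_source.
Context {R : realType} {L : nat} (Theta : 'M[R]_L) (lam : 'I_L -> R).
Context (PX : probability (L.-tuple R) R).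
Hypotheses (ThetaK : Theta^T *m Theta = 1%:M) (lam0 : forall l, 0 < lam l).
Hypothesis gPX : gaussian_law PX (covmx Theta lam).

Definition whiten (l : 'I_L) (x : L.-tuple R) : R :=
  rot Theta x l / Num.sqrt (lam l).

Lemma measurable_whiten l : measurable_fun [set: L.-tuple R] (whiten l).
Proof. by apply: measurable_funM => //; exact: measurable_rot. Qed.

Let coef (a : 'I_L -> R) : L.-tuple R :=
  [tuple \sum_l a l / Num.sqrt (lam l) * Theta l i | i < L].

Let coefE a x :
  \sum_i tnth (coef a) i * tnth x i = \sum_l a l * whiten l x.
Proof.
under eq_bigr do rewrite tnth_mktuple big_distrl/=.
rewrite exchange_big/=; apply: eq_bigr => l _.
rewrite /whiten /rot big_distrl/= big_distrr/=.
by apply: eq_bigr => i _; ring.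
Qed.

Let coef_var a : \sum_(i < L) \sum_(j < L)
  tnth (coef a) i * covmx Theta lam i j * tnth (coef a) j = \sum_l a l ^+ 2.
Proof.
pose av : 'rV[R]_L := \row_l (a l / Num.sqrt (lam l)).
have coefM i : tnth (coef a) i = (av *m Theta) 0 i.
  by rewrite tnth_mktuple mxE; apply: eq_bigr => l _; rewrite mxE.
transitivity ((av *m Theta *m covmx Theta lam *m (av *m Theta)^T) 0 0).
  rewrite mxE; under [RHS]eq_bigr do rewrite mxE big_distrl/=.
  rewrite exchange_big/=; apply: eq_bigr => i _; apply: eq_bigr => j _.
  by rewrite [(_)^T _ _]mxE -!coefM.
rewrite /covmx trmx_mul !mulmxA -(mulmxA av) (mulmx1C ThetaK) mulmx1.
rewrite -(mulmxA _ Theta) (mulmx1C ThetaK) mulmx1.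
rewrite mxE; apply: eq_bigr => l _; rewrite mul_mx_diag !mxE.
have l0 : Num.sqrt (lam l) != 0 by rewrite gt_eqF ?sqrtr_gt0.
rewrite -[X in _ * X * _ = _](sqr_sqrtr (ltW (lam0 l))).
by field.
Qed.

Let law a : (exists l, a l != 0) -> let s := Num.sqrt (\sum_l a l ^+ 2) in
  0 < s /\ forall (f : measurableTypeR R -> R) v,
    has_integral (normal_prob 0 s) f v ->
    has_integral PX (fun x => f (\sum_l a l * whiten l x)) v.
Proof.
move=> [l al] s.
have sa0 : 0 < \sum_l a l ^+ 2.
  rewrite (bigD1 l)//= ltr_pwDl// ?exprn_even_gt0//.
  by apply: sumr_ge0 => j _; exact: sqr_ge0.
split; first by rewrite sqrtr_gt0.
move=> f v hf.
(* The covariance form at [coef a] equals the positive number [\sum_l a l ^+ 2], so the vector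
   cannot vanish. *)
have nz : exists i, tnth (coef a) i != 0.
  apply/existsP; apply: contraTT sa0; rewrite negb_exists => /forallP c0.
  rewrite -coef_var big1 ?ltxx// => i _; rewrite big1// => j _.
  by have /eqP -> := negPn (c0 i); rewrite !mul0r.
pose phi (x : L.-tuple R) : measurableTypeR R := \sum_l a l * whiten l x.
have mphi : measurable_fun [set: L.-tuple R] phi.
  have : measurable_fun [set: L.-tuple R] (fun x => \sum_l a l * whiten l x).
    by apply: measurable_sum => j; apply: measurable_funM => //; exact: measurable_whiten.
  by [].
apply: (has_integral_law mphi _ hf) => U mU.
have := gPX nz mU; rewrite coef_var => h; apply: etrans (esym h) _.
by congr (PX _); apply/funext => x /=; rewrite coefE.
Qed.

Lemma whiten_standard_gaussian : standard_gaussian PX whiten.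
Proof.
split; first exact: measurable_whiten.
move=> a b.
(* [gaussian_law] says nothing about the zero vector; there the cosine is constant. *)
have [a0|na0] := pselect (exists l, a l != 0); last first.
  have {}na0 l : a l = 0.
    by apply/eqP; apply: contrapT => al; apply: na0; exists l; apply/negP.
  apply: eq_has_integral (has_integral_cst PX (cos b)) => [x|].
    by rewrite big1 ?sub0r ?cosN// => l _; rewrite na0 mul0r.
  by rewrite big1 ?oppr0 ?expR0 ?mulr1// => l _; rewrite na0 expr0n mul0r.
have [s0 hlaw] := law a0.
set s := Num.sqrt _ in s0 hlaw.
have mid : measurable_fun [set: measurableTypeR R]
    (fun x : measurableTypeR R => x : R) by exact: (@measurable_id _ R setT).
have msin : measurable_fun [set: measurableTypeR R]
    (fun x : measurableTypeR R => sin (x : R)).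
  by apply: measurableT_comp => //; apply: continuous_measurable_fun; exact: continuous_sin.
pose v := \int[normal_prob 0 s]_x sin x.
have hv : has_integral (normal_prob 0 s) (fun x => sin x) v.
  apply: (bounded_has_integral (C := 1) _ msin) => x.
  by rewrite ler_norml sin_geN1 sin_le1.
have h1 := hlaw _ _ hv.
(* The opposite combination has the same law, so the sine averages to zero. *)
have Na0 : exists l, - a l != 0 by case: a0 => l al; exists l; rewrite oppr_eq0.
have [_ Nlaw] := law Na0.
have sE : Num.sqrt (\sum_l (- a l) ^+ 2) = s.
  by congr Num.sqrt; apply: eq_bigr => l _; rewrite sqrrN.
rewrite sE in Nlaw.
have h2 := Nlaw _ _ hv.
have v0 : v = 0.
  have : v = - v; last by lra.
  apply: (has_integral_unique h2).
  apply: eq_has_integral (has_integralZ (- 1) h1) => [x|]; last by rewrite mulN1r.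
  rewrite mulN1r -sinN -sumrN; congr sin; apply: eq_bigr => l _.
  by rewrite mulNr.
have hc := hlaw _ _ (normal_cos s0 1).
apply: eq_has_integral (has_integralD (has_integralZ (cos b) hc)
  (has_integralZ (sin b) h1)) => [x|].
  by rewrite cosB mul1r mulrC [sin b * _]mulrC.
rewrite v0 mulr0 addr0 expr1n mulr1 sqr_sqrtr; last first.
  by apply: sumr_ge0 => l _; exact: sqr_ge0.
by rewrite mulr_suml.
Qed.

Lemma whiten_second_moment l : has_integral PX (fun x => whiten l x ^+ 2) 1.
Proof.
pose a j : R := (j == l)%:R.
have a0 : exists j, a j != 0 by exists l; rewrite /a eqxx oner_neq0.
have [s0 hlaw] := law a0.
have sE : \sum_j a j ^+ 2 = 1.
  rewrite (bigD1 l)//= /a eqxx expr1n big1 ?addr0// => j /negPf ->.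
  by rewrite expr0n.
rewrite sE sqrtr1 in s0 hlaw.
have := hlaw _ _ (normal_second_moment s0).
apply: eq_has_integral => [x|]; last by rewrite expr1n.
rewrite (bigD1 l)//= /a eqxx mul1r big1 ?addr0// => j /negPf ->.
by rewrite mul0r.
Qed.

End gaussian_source.

(** * Achievability *)

Lemma probability_law d1 d2 (T1 : measurableType d1) (T2 : measurableType d2)
    (R : realType) (P : probability T1 R) (phi : T1 -> T2) :
  measurable_fun [set: T1] phi ->
  exists Q : probability T2 R, forall U, Q U = P (phi @^-1` U).
Proof.
move=> mphi.
pose f : {mfun T1 >-> T2} := HB.pack phi (isMeasurableFun.Build _ _ _ _ phi mphi).
by exists (distribution P f).
Qed.

Section density_kernel.
Context dx dw dy (X : measurableType dx) (W : measurableType dw)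
  (Y : measurableType dy) (R : realType).
Variables (P : probability W R) (h : X -> W -> R) (phi : W -> Y).
Hypotheses (h0 : forall x w, 0 <= h x w)
  (mh : measurable_fun [set: X * W] (fun z => h z.1 z.2))
  (mphi : measurable_fun [set: W] phi)
  (h1 : forall x, has_integral P (h x) 1).

(** The channel draws [w] from [P] reweighted by [h x] and outputs [phi w]. Putting the density on
    [w] rather than on the output allows a [phi] that is not injective, as happens when some
    [lamh l = 0]. *)
Definition density_kernel (x : X) (B : set Y) : \bar R :=
  (\int[P]_w (\1_B (phi w) * h x w)%:E)%E.

Let kap x w : {measure set Y -> \bar R} := mscale (NngNum (h0 x w)) (\d_ (phi w)).

Let kapE x w U : kap x w U = (\1_U (phi w) * h x w)%:E.
Proof. by rewrite /kap /mscale/= mulrC. Qed.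

Let mind U : measurable U -> measurable_fun [set: W] (fun w => \1_U (phi w) : R).
Proof.
by move=> mU; apply: (@measurableT_comp _ _ _ _ _ _ (\1_U : Y -> R)).
Qed.

Let mkap U x : measurable U -> measurable_fun [set: W] (fun w => kap x w U).
Proof.
move=> mU; under eq_fun do rewrite kapE.
apply/measurable_EFinP/measurable_funM; first exact: mind.
exact: has_integral_measurable (h1 x).
Qed.

Let density_kernelE x U : density_kernel x U = (\int[P]_w kap x w U)%E.
Proof. by apply: eq_integral => w _; rewrite kapE. Qed.

Let density_kernel0 x : density_kernel x set0 = 0%E.
Proof. by apply: integral0_eq => w _; rewrite indic0 mul0r. Qed.

Let density_kernel_ge0 x U : (0 <= density_kernel x U)%E.
Proof. by apply: integral_ge0 => w _; rewrite lee_fin mulr_ge0. Qed.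

Let density_kernel_sigma_additive x : semi_sigma_additive (density_kernel x).
Proof.
move=> U mU tU mUU; rewrite density_kernelE [X in _ --> X](_ : _ =
  \int[P]_w (\sum_(n <oo) kap x w (U n)))%E; last first.
  apply: eq_integral => w _.
  by apply/esym/cvg_lim => //; exact/measure_semi_sigma_additive.
apply/cvg_closeP; split.
  by apply: is_cvg_nneseries => n _ _; exact: density_kernel_ge0.
rewrite closeE// integral_nneseries//; last by move=> n; exact: mkap.
by congr (limn _); apply/funext => n; apply: eq_bigr => i _; exact: density_kernelE.
Qed.

HB.instance Definition _ x := isMeasure.Build _ _ R
  (density_kernel x) (density_kernel0 x) (density_kernel_ge0 x)
  (@density_kernel_sigma_additive x).

Definition mdensity_kernel : X -> {measure set Y -> \bar R} := density_kernel.

Let measurable_density_kernel U : measurable U ->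
  measurable_fun [set: X] (mdensity_kernel ^~ U).
Proof.
move=> mU; pose f (z : X * W) := (\1_U (phi z.2) * h z.1 z.2)%:E.
apply: (@measurable_fun_fubini_tonelli_F _ _ _ _ _ P f).
- apply/measurable_EFinP/measurable_funM => //.
  exact: (measurableT_comp (mind mU) measurable_snd).
- by move=> z; rewrite lee_fin mulr_ge0.
Qed.

HB.instance Definition _ := isKernel.Build _ _ X Y R
  mdensity_kernel measurable_density_kernel.

Let density_kernelT x : mdensity_kernel x setT = 1%E.
Proof.
rewrite /mdensity_kernel/= /density_kernel.
under eq_integral do rewrite indicT mul1r.
exact: has_integralE (h1 x).
Qed.

HB.instance Definition _ := Kernel_isProbability.Build _ _ X Y R
  mdensity_kernel density_kernelT.

Definition pdensity_kernel : R.-pker X ~> Y := mdensity_kernel.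

Lemma ge0_integral_density_kernel x (f : Y -> R) : measurable_fun [set: Y] f ->
  (forall y, 0 <= f y) ->
  (\int[pdensity_kernel x]_y (f y)%:E = \int[P]_w (f (phi w) * h x w)%:E)%E.
Proof.
move=> mf f0.
rewrite (@ge0_integral_mixture _ _ _ _ _ P (kap x)); last first.
- exact/measurable_EFinP.
- by move=> y; rewrite lee_fin.
- by move=> U mU; exact: density_kernelE.
- by move=> U mU; exact: mkap.
apply: eq_integral => w _.
rewrite /kap ge0_integral_mscale//; last 2 first.
  exact/measurable_EFinP.
  by move=> y _; rewrite lee_fin.
rewrite integral_dirac//; last exact/measurable_EFinP.
by rewrite diracT mul1e mulrC.
Qed.

End density_kernel.

(* [t = ln (p / Q)] gives the bound when [p, Q > 0]; extreme values of [t] rule out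
   [Q = 0 < p] and settle [p = 0]. *)
Lemma mi_term_le {R : realType} (p q r I : R) : 0 <= p -> 0 <= q * r ->
  (forall t, t * p + p - expR t * (q * r) <= I) -> mi_term p q r <= I.
Proof.
move=> p0 Q0 H; rewrite /mi_term; case: eqP => [p00|/eqP pN0].
  rewrite leNgt; apply/negP => I0.
  have Q1 : 0 < q * r + 1 by rewrite ltr_pwDr.
  have e0 : 0 < - I / (2 * (q * r + 1)) by rewrite divr_gt0 ?oppr_gt0// mulr_gt0.
  have := H (ln (- I / (2 * (q * r + 1)))).
  rewrite p00 mulr0 !add0r lnK ?posrE// leNgt => /negP; apply.
  rewrite ltrNr.
  have -> : - I / (2 * (q * r + 1)) * (q * r) = - I * (q * r / (2 * (q * r + 1))).
    by field; rewrite gt_eqF.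
  have : q * r / (2 * (q * r + 1)) < 1.
    by rewrite ltr_pdivrMr ?mulr_gt0// mul1r; lra.
  have : 0 <= q * r / (2 * (q * r + 1)) by rewrite divr_ge0// mulr_ge0// ltW.
  nra.
have {}p0 : 0 < p by rewrite lt_neqAle eq_sym pN0.
have [Q00|QN0] := eqVneq (q * r) 0.
  have := H (I / p); rewrite Q00 mulr0 subr0 divfK// -subr_le0 addrAC subrr add0r.
  by rewrite leNgt p0.
have {}Q0 : 0 < q * r by rewrite lt_neqAle eq_sym QN0.
apply: le_trans (H (ln (p / (q * r)))).
by rewrite lnK ?posrE ?divr_gt0// divfK// addrK mulrC.
Qed.

Lemma sum_indic_partition {R : realType} {L : nat} (m : nat)
  (A : 'I_m -> set (L.-tuple R)) x : is_partition A ->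
  \sum_i \1_(A i) x = 1 :> R.
Proof.
move=> [_ dA cA]; have [i Ai] := cA x.
rewrite (bigD1 i)//= indicE mem_set// big1 ?addr0// => j ji.
rewrite indicE memNset// => Aj.
by have : (A j `&` A i) x by []; rewrite dA.
Qed.

Section achievability.
Context {R : realType} {L : nat} (Theta : 'M[R]_L) (lam : 'I_L -> R).
Context (PX : probability (L.-tuple R) R).
Hypotheses (ThetaK : Theta^T *m Theta = 1%:M) (lam0 : forall l, 0 < lam l).
Hypothesis gPX : gaussian_law PX (covmx Theta lam).
Variables (lamh r : 'I_L -> R).
Hypotheses (lamh0 : forall l, 0 <= lamh l) (r01 : forall l, 0 < r l < 1).
Local Notation V := (L.-tuple R).
Local Notation u := (whiten Theta lam).

Let r1 l : `|r l| < 1.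
Proof. by have /andP[r0 ?] := r01 l; rewrite gtr0_norm. Qed.

Let gu := whiten_standard_gaussian ThetaK lam0 gPX.

Let mu l : measurable_fun [set: V] (u l). Proof. exact: measurable_whiten. Qed.

(** In each rotated coordinate, the increasing linear map from variance [lam l] to variance
    [lamh l]. It shapes the channel output and also gives the coupling that attains
    [(sqrt lam - sqrt lamh)^2]. *)
Let phi (x : V) : V := unrot Theta (fun l => Num.sqrt (lamh l) * u l x).

Let mphi : measurable_fun [set: V] phi.
Proof. by apply: measurable_unrot => l; exact: measurable_funM. Qed.

Let M (x y : V) := \sum_l mehler (r l) (u l x) (u l y).
Let W x y := expR (M x y).

Let MC x y : M x y = M y x.
Proof. by apply: eq_bigr => l _; exact: mehlerC. Qed.

Let mu1 l : measurable_fun [set: V * V] (fun z => u l z.1).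
Proof. exact: measurableT_comp. Qed.

Let mu2 l : measurable_fun [set: V * V] (fun z => u l z.2).
Proof. exact: measurableT_comp. Qed.

Let mM : measurable_fun [set: V * V] (fun z => M z.1 z.2).
Proof.
by apply: measurable_sum => l; exact: measurable_mehler.
Qed.

Let mW : measurable_fun [set: V * V] (fun z => W z.1 z.2).
Proof. exact: measurableT_comp. Qed.

Let W0 x y : 0 <= W x y. Proof. exact: expR_ge0. Qed.

Let W1l y : has_integral PX (W ^~ y) 1. Proof. exact: has_integral_mehler. Qed.

Let W1r x : has_integral PX (W x) 1.
Proof. by apply: eq_has_integral (W1l x) => // y; rewrite /W MC. Qed.

Local Notation PP := (PX \x PX)%E.

Let hW : has_integral PP (fun z => W z.1 z.2) 1.
Proof. exact: (ge0_has_integral_prod2 mW W0 W1l (has_integral_cst PX 1)). Qed.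

Let hu1 l : has_integral PP (fun z => u l z.1 ^+ 2 * W z.1 z.2) 1.
Proof.
apply: (@ge0_has_integral_prod1 _ _ _ _ _ PX PX
  (fun x y => u l x ^+ 2 * W x y) _ (fun x => u l x ^+ 2 * 1)).
- by apply: measurable_funM => //; exact: measurable_funX.
- by move=> x y; rewrite mulr_ge0// sqr_ge0.
- by move=> x; exact: has_integralZ.
- by apply: eq_has_integral (whiten_second_moment ThetaK lam0 gPX l) => // x; rewrite mulr1.
Qed.

Let hu2 l : has_integral PP (fun z => u l z.2 ^+ 2 * W z.1 z.2) 1.
Proof.
apply: (@ge0_has_integral_prod2 _ _ _ _ _ PX PX
  (fun x y => u l y ^+ 2 * W x y) _ (fun x => u l x ^+ 2 * 1)).
- by apply: measurable_funM => //; exact: measurable_funX.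
- by move=> x y; rewrite mulr_ge0// sqr_ge0.
- by move=> y; exact: has_integralZ.
- by apply: eq_has_integral (whiten_second_moment ThetaK lam0 gPX l) => // x; rewrite mulr1.
Qed.

Let hu12 l : has_integral PP
  (fun z => (u l z.1 - r l * u l z.2) ^+ 2 * W z.1 z.2) (1 - r l ^+ 2).
Proof.
apply: (@ge0_has_integral_prod2 _ _ _ _ _ PX PX
  (fun x y => (u l x - r l * u l y) ^+ 2 * W x y) _ (fun=> 1 - r l ^+ 2)).
- apply: measurable_funM => //; apply: measurable_funX; apply: measurable_funB => //.
  exact: measurable_funM.
- by move=> x y; rewrite mulr_ge0// sqr_ge0.
- by move=> y; exact: (has_integral_mehler_sqr gu (fun l => u l y) l r01).
- exact: has_integral_cst.
Qed.

Let hdist : has_integral PP (fun z => sqdist z.1 (phi z.2) * W z.1 z.2)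
  (\sum_l (lam l - 2 * (Num.sqrt (lam l) * Num.sqrt (lamh l) * r l) + lamh l)).
Proof.
(* [2 r u v = u^2 + r^2 v^2 - (u - r v)^2] *)
pose k l := Num.sqrt (lam l) * Num.sqrt (lamh l) / r l.
have H l := has_integralD (has_integralD
  (has_integralZ (lam l - k l) (hu1 l))
  (has_integralZ (lamh l - k l * r l ^+ 2) (hu2 l)))
  (has_integralZ (k l) (hu12 l)).
apply: eq_has_integral (has_integral_sum (index_enum _) H) => [z|].
  rewrite (sqdist_rot ThetaK) mulr_suml; apply: eq_bigr => l _.
  have rN0 : r l != 0 by have /andP[?] := r01 l; rewrite gt_eqF.
  have lN0 : Num.sqrt (lam l) != 0 by rewrite gt_eqF ?sqrtr_gt0.
  rewrite /phi unrotK// -(divfK lN0 (rot _ _ _)) -/(u l z.1) /k.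
  have := sqr_sqrtr (ltW (lam0 l)); have := sqr_sqrtr (lamh0 l).
  set a := Num.sqrt (lam l); set b := Num.sqrt (lamh l); move: a b => a b.
  by move=> <- <-; field.
apply: eq_bigr => l _.
have rN0 : r l != 0 by have /andP[?] := r01 l; rewrite gt_eqF.
by rewrite /k; field.
Qed.

(** The mean of the log-density under the density itself. Its two quadratic terms have means [1/2]
    and [-1/2], which leaves only the logarithm. *)
Let hMW : has_integral PP (fun z => M z.1 z.2 * W z.1 z.2)
  (2^-1 * \sum_l - ln (1 - r l ^+ 2)).
Proof.
have H l := has_integralB (has_integralB (has_integralZ 2^-1 (hu1 l))
  (has_integralZ (2 * (1 - r l ^+ 2))^-1 (hu12 l)))
  (has_integralZ (ln (1 - r l ^+ 2) / 2) hW).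
apply: eq_has_integral (has_integral_sum (index_enum _) H) => [z|].
  by rewrite /M mulr_suml; apply: eq_bigr => l _; rewrite /mehler; ring.
rewrite mulr_sumr; apply: eq_bigr => l _.
by field; rewrite gt_eqF// subr1_sqr_gt0.
Qed.

Let k : R.-pker V ~> V := pdensity_kernel W0 mW mphi W1r.

(** For each [y] the density averages to 1 over [x], so the reweighting disappears from the second
    marginal and the auxiliary variable keeps the source law. *)
Let out_lawE B : measurable B -> out_law PX k B = PX (phi @^-1` B).
Proof.
move=> mB; have mB' : measurable (phi @^-1` B).
  by rewrite -[X in measurable X]setTI; exact: mphi.
rewrite /out_law /k /=.
have := @fubini_tonelli _ _ _ _ _ PX PX (fun z => (\1_B (phi z.2) * W z.1 z.2)%:E).
move=> ->.
- transitivity (\int[PX]_y (\1_(phi @^-1` B) y)%:E)%E; last first.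
    by rewrite integral_indic// setIT.
  apply: eq_integral => y _.
  by rewrite /= (has_integralE (has_integralZ _ (W1l y))) mulr1.
- apply/measurable_EFinP/measurable_funM => //.
  apply: (@measurableT_comp _ _ _ _ _ _ (\1_B : V -> R)) => //.
  exact: measurableT_comp.
- by move=> z; rewrite lee_fin mulr_ge0.
Qed.

Let C (A B : set V) (z : V * V) : R := \1_A z.1 * \1_B (phi z.2).

Let mC A B : measurable A -> measurable B -> measurable_fun [set: V * V] (C A B).
Proof.
move=> mA mB; apply: measurable_funM.
  by apply: (@measurableT_comp _ _ _ _ _ _ (\1_A : V -> R)).
apply: (@measurableT_comp _ _ _ _ _ _ (\1_B : V -> R)) => //.
exact: measurableT_comp.
Qed.

Let C01 A B z : 0 <= C A B z <= 1.
Proof.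
by rewrite /C !indicE -natrM ler0n lern1 mulnb leq_b1.
Qed.

Let hC A B : measurable A -> measurable B ->
  has_integral PP (C A B) (fine (PX A) * fine (out_law PX k B)).
Proof.
move=> mA mB.
have mB' : measurable (phi @^-1` B).
  by rewrite -[X in measurable X]setTI; exact: mphi.
have hI (D : set V) : measurable D -> has_integral PX (\1_D : V -> R) (fine (PX D)).
  move=> mD; apply: ge0_has_integral => //.
  by rewrite integral_indic// setIT fineK// fin_num_measure.
apply: (@ge0_has_integral_prod1 _ _ _ _ _ PX PX
  (fun x y => \1_A x * \1_B (phi y)) _ (fun x => \1_A x * fine (out_law PX k B))).
- exact: mC.
- by move=> x y; rewrite mulr_ge0.
- by move=> x; apply: has_integralZ; rewrite out_lawE//; exact: hI.
- rewrite mulrC; apply: eq_has_integral (has_integralZ _ (hI A mA)) => // x.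
  by rewrite mulrC.
Qed.

Let joint_rectE A B : measurable A -> measurable B ->
  has_integral PP (fun z => C A B z * W z.1 z.2) (fine (joint_rect PX k A B)).
Proof.
move=> mA mB.
have mCW : measurable_fun [set: V * V] (fun z => C A B z * W z.1 z.2).
  by apply: measurable_funM => //; exact: mC.
have hi : has_integral PP (fun z => C A B z * W z.1 z.2)
    (\int[PP]_z (C A B z * W z.1 z.2)).
  apply: (has_integral_dom mCW hW) => z; have /andP[c0 c1] := C01 A B z.
  by rewrite normrM !ger0_norm// ler_piMl.
apply: eq_has_integral hi => //; rewrite /Rintegral; congr fine.
rewrite (@fubini_tonelli1 _ _ _ _ _ PX PX (fun z => (C A B z * W z.1 z.2)%:E)); last 2 first.
- exact/measurable_EFinP.
- by move=> z; rewrite lee_fin mulr_ge0//; case/andP: (C01 A B z).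
rewrite /joint_rect [RHS]integral_mkcond; apply: eq_integral => x _.
rewrite /fubini_F /= patchE; case: ifPn => xA; last first.
  by rewrite integral0_eq// => y _; rewrite /C/= indicE (negPf xA) !mul0r.
by rewrite /k/=; apply: eq_integral => y _; rewrite /C/= indicE xA mul1r.
Qed.

(** A log-sum inequality on each cell: [t W + W - expR t <= M W] holds pointwise, from
    [1 + x <= expR x] at [x = t - M]; after integration over the cell, [mi_term_le] chooses [t]. The
    cells of a partition add up to the integral in [hMW]. *)
Let mutual_info_le : (mutual_info PX k <=
  (2^-1 * \sum_l - ln (1 - r l ^+ 2))%:E)%E.
Proof.
apply: ge_ereal_sup => _ [m [n [A [B [pA pB ->]]]]]; rewrite lee_fin.
have [mA _ _] := pA; have [mB _ _] := pB.
have hI i j : has_integral PP (fun z => C (A i) (B j) z * (M z.1 z.2 * W z.1 z.2))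
    (\int[PP]_z (C (A i) (B j) z * (M z.1 z.2 * W z.1 z.2))).
  apply: (has_integral_dom (g := fun z => `|M z.1 z.2 * W z.1 z.2|)).
  - apply: measurable_funM; first exact: mC.
    exact: measurable_funM.
  - by split; [exact: integrable_norm hMW.1|reflexivity].
  - move=> z; have /andP[c0 c1] := C01 (A i) (B j) z.
    by rewrite normrM ger0_norm// ler_piMl.
have sumI : \sum_(i < m) \sum_(j < n)
    \int[PP]_z (C (A i) (B j) z * (M z.1 z.2 * W z.1 z.2)) =
    2^-1 * \sum_l - ln (1 - r l ^+ 2).
  apply: has_integral_unique hMW.
  have := has_integral_sum (index_enum _)
    (fun i => has_integral_sum (index_enum _) (hI i)).
  apply: eq_has_integral => // z.
  under eq_bigr do rewrite -mulr_suml -mulr_sumr.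
  rewrite -!mulr_suml !sum_indic_partition// !mul1r //.
rewrite -sumI; apply: ler_sum => i _; apply: ler_sum => j _.
apply: mi_term_le.
- apply: (le_has_integral (has_integral0 _) (joint_rectE (mA i) (mB j))) => z.
  by rewrite mulr_ge0//; case/andP: (C01 (A i) (B j) z).
- apply: (le_has_integral (has_integral0 _) (hC (mA i) (mB j))) => z.
  by case/andP: (C01 (A i) (B j) z).
move=> t.
have hp := joint_rectE (mA i) (mB j).
apply: (le_has_integral (has_integralB (has_integralD (has_integralZ t hp) hp)
  (has_integralZ (expR t) (hC (mA i) (mB j)))) (hI i j)) => z.
have /andP[c0 c1] := C01 (A i) (B j) z.
have -> : t * (C (A i) (B j) z * W z.1 z.2) + C (A i) (B j) z * W z.1 z.2 -
  expR t * C (A i) (B j) z =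
  C (A i) (B j) z * (t * W z.1 z.2 + W z.1 z.2 - expR t) by ring.
rewrite ler_wpM2l//.
have := expR_ge1Dx (t - M z.1 z.2); rewrite expRD expRN -/(W _ _) => h.
have w0 : 0 < W z.1 z.2 by exact: expR_gt0.
have := ler_wpM2r (ltW w0) h; rewrite divfK ?gt_eqF//; lra.
Qed.

Lemma RDP_le D Q :
  \sum_l (lam l - 2 * (Num.sqrt (lam l) * Num.sqrt (lamh l) * r l) + lamh l) <= D ->
  \sum_l (Num.sqrt (lam l) - Num.sqrt (lamh l)) ^+ 2 <= Q ->
  (RDP PX D Q <= (2^-1 * \sum_l - ln (1 - r l ^+ 2))%:E)%E.
Proof.
move=> hD hQ; apply: le_trans mutual_info_le; apply: ge_ereal_inf.
exists (mutual_info PX k) => //; exists k => //; split.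
  rewrite /exp_distortion.
  have mdist (x : V) : measurable_fun [set: V] (sqdist x).
    exact: (measurableT_comp measurable_sqdist (pair1_measurable x)).
  under eq_integral => x _ do rewrite
    (ge0_integral_density_kernel W0 mW mphi W1r x (mdist x) (sqdist_ge0 x)).
  have := has_integralE hdist; rewrite fubini_tonelli1.
  - by move=> ->; rewrite lee_fin.
  - by apply/measurable_EFinP; exact: has_integral_measurable hdist.
  - by move=> z; rewrite lee_fin mulr_ge0// sqdist_ge0.
have mpair : measurable_fun [set: V] (fun x => (x, phi x)).
  exact: measurable_fun_pair.
have [g gE] := probability_law PX mpair.
apply: (@le_trans _ _ (\int[g]_z (sqdist z.1 z.2)%:E)%E).
  apply: ereal_inf_lbound; exists g => //; split => B mB; rewrite gE.
    by congr (PX _); apply/seteqP; split => x /=; [case|].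
  by rewrite out_lawE//; congr (PX _); apply/seteqP; split => x /=; [case|].
rewrite (ge0_integral_law mpair (fun U _ => gE U) measurable_sqdist); last first.
  by move=> z; exact: sqdist_ge0.
have H l := has_integralZ ((Num.sqrt (lam l) - Num.sqrt (lamh l)) ^+ 2)
  (whiten_second_moment ThetaK lam0 gPX l).
have : has_integral PX (fun x => sqdist x (phi x))
    (\sum_l (Num.sqrt (lam l) - Num.sqrt (lamh l)) ^+ 2).
  apply: eq_has_integral (has_integral_sum (index_enum _) H) => [x|].
    rewrite (sqdist_rot ThetaK); apply: eq_bigr => l _.
    have lN0 : Num.sqrt (lam l) != 0 by rewrite gt_eqF ?sqrtr_gt0.
    by rewrite /phi unrotK// -(divfK lN0 (rot _ _ _)) -/(u l x); ring.
  by apply: eq_bigr => l _; rewrite mulr1.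
by move=> /has_integralE ->; rewrite lee_fin.
Qed.

End achievability.

(** * Converse *)

Section mixture_measure.
Local Open Scope ereal_scope.
Context d1 d2 (X : measurableType d1) (Z : measurableType d2) (R : realType).
Variables (mu : {measure set X -> \bar R}) (kap : X -> {measure set Z -> \bar R}).
Hypothesis mkap :
  forall U, measurable U -> measurable_fun [set: X] (fun x => kap x U).

Definition mixture (U : set Z) : \bar R := \int[mu]_x kap x U.

Let mixture0 : mixture set0 = 0.
Proof. by apply: integral0_eq => x _; rewrite measure0. Qed.

Let mixture_ge0 U : 0 <= mixture U.
Proof. exact: integral_ge0. Qed.

Let mixture_sigma_additive : semi_sigma_additive mixture.
Proof.
move=> U mU tU mUU; rewrite [X in _ --> X](_ : _ =
  \int[mu]_x (\sum_(n <oo) kap x (U n))); last first.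
  apply: eq_integral => w _.
  by apply/esym/cvg_lim => //; exact/measure_semi_sigma_additive.
apply/cvg_closeP; split.
  by apply: is_cvg_nneseries => n _ _; exact: mixture_ge0.
by rewrite closeE// integral_nneseries// => n; exact: mkap.
Qed.

HB.instance Definition _ := isMeasure.Build _ _ R
  mixture mixture0 mixture_ge0 mixture_sigma_additive.

Definition mixture_measure : {measure set Z -> \bar R} := mixture.

End mixture_measure.

Section joint_law.
Context d1 d2 (X : measurableType d1) (Y : measurableType d2) (R : realType).
Variables (P : probability X R) (k : R.-pker X ~> Y).

Let mpair (x : X) : measurable_fun [set: Y] (fun y : Y => (x, y)).
Proof. exact: measurable_fun_pair. Qed.

Let kap (x : X) : {measure set (X * Y) -> \bar R} :=
  measure_function_pushforward__canonical__measure_function_Measure (k x) (mpair x).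

Let kapE x U : kap x U = k x (xsection U x).
Proof. by rewrite /kap /= /pushforward xsectionE. Qed.

Let mkap U : measurable U -> measurable_fun [set: X] (fun x => kap x U).
Proof.
move=> mU; under eq_fun do rewrite kapE.
have [r hr] := measure_uub k.
by apply: measurable_fun_xsection_finite_kernel => // /[!inE].
Qed.

Let joint0 : {measure set (X * Y) -> \bar R} := mixture_measure P mkap.

Let joint0E (F : X * Y -> R) : measurable_fun [set: X * Y] F ->
  (forall z, 0 <= F z) ->
  (\int[joint0]_z (F z)%:E = \int[P]_x \int[k x]_y (F (x, y))%:E)%E.
Proof.
move=> mF F0; rewrite (@ge0_integral_mixture _ _ _ _ _ P kap).
- apply: eq_integral => x _; rewrite (@ge0_integral_law _ _ _ _ _ (k x) (kap x) (pair x))//.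
- exact: mkap.
- by [].
- by move=> z; rewrite lee_fin.
- exact/measurable_EFinP.
Qed.

Let joint0T : joint0 setT = 1%E.
Proof.
rewrite /joint0 /mixture_measure /= /mixture.
under eq_integral do rewrite kapE xsectionE preimage_setT prob_kernel.
by rewrite integral_cst// mul1e; exact: probability_setT.
Qed.

(** One probability carries the iterated integral of the channel, so that the moments of input and
    output and their cross moments are integrals against a single measure. *)
Lemma joint_law : exists J : probability (X * Y)%type R,
  forall F : X * Y -> R, measurable_fun [set: X * Y] F -> (forall z, 0 <= F z) ->
  (\int[J]_z (F z)%:E = \int[P]_x \int[k x]_y (F (x, y))%:E)%E.
Proof.
pose J : probability (X * Y)%type R :=
  HB.pack (joint0 : set (X * Y) -> \bar R) (Measure.on joint0)
    (Measure_isProbability.Build _ _ R joint0 joint0T).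
by exists J => F mF F0; exact: joint0E.
Qed.

End joint_law.

(** * Quantisation and information on finite alphabets *)

Section approx.
Import HBNNSimple.

(** Simple functions from below, for the positive and the negative part. The finite range yields
    finite partitions, and [q n t ^+ 2 <= t ^+ 2] keeps one dominating function valid at every stage
    of quantisation. *)
Lemma measurable_approx_finite {R : realType} : exists (q : nat -> R -> R)
    (s : nat -> seq R),
  [/\ forall n, measurable_fun [set: R] (q n),
      forall n t, q n t \in s n,
      forall n t, q n t ^+ 2 <= t ^+ 2 &
      forall t, q n t @[n --> \oo] --> t].
Proof.
have approx (f : R -> R) : measurable_fun [set: R] f -> (forall t, 0 <= f t) ->
    exists (q : nat -> R -> R) (s : nat -> seq R),
    [/\ forall n, measurable_fun [set: R] (q n), forall n t, q n t \in s n,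
      forall n t, 0 <= q n t <= f t & forall t, q n t @[n --> \oo] --> f t].
  move=> mf f0; have mf' : measurable_fun [set: R] (EFin \o f) by exact/measurable_EFinP.
  pose q := nnsfun_approx measurableT mf'.
  have cq t : q n t @[n --> \oo] --> f t.
    have : (q n t)%:E @[n --> \oo] --> (f t)%:E.
      by apply: cvg_nnsfun_approx => // x _; rewrite lee_fin.
    exact: fine_cvg.
  have fq n : exists s : seq R, range (q n) = [set` s].
    by apply/finite_seqP; exact: fimfunP.
  have [s sE] := choice fq.
  exists (fun n => q n), s; split => // [n t|n t].
    have : range (q n) (q n t) by exists t.
    by rewrite sE.
  apply/andP; split => //; rewrite -(cvg_lim _ (cq t))//.
  apply: (nondecreasing_cvgn_le (u_ := fun n => q n t)).
    by move=> a b ab; exact/lefP/nd_nnsfun_approx.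
  by apply/cvg_ex; exists (f t).
have mid : measurable_fun [set: R] (fun t : R => t) by exact: measurable_id.
have mN : measurable_fun [set: R] (fun t : R => - t) by exact: measurableT_comp.
have [||p [sp [mp ps p0 cp]]] := approx (fun t => Num.max t 0).
  exact: measurable_maxr.
  by move=> t; rewrite le_max lexx orbT.
have [||m [sm [mm ms m0 cm]]] := approx (fun t => Num.max (- t) 0).
  exact: measurable_maxr.
  by move=> t; rewrite le_max lexx orbT.
exists (fun n t => p n t - m n t), (fun n => [seq a - b | a <- sp n, b <- sm n]).
split => [n|n t|n t|t].
- exact: measurable_funB.
- exact: allpairs_f.
- have := p0 n t; have := m0 n t.
  by rewrite /Num.max; case: ltP => h1; case: ltP => h2 /andP[? ?] /andP[? ?]; nra.
- rewrite [X in _ --> X](_ : _ = Num.max t 0 - Num.max (- t) 0); first exact: cvgB.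
  by rewrite /Num.max; case: ltP => h1; case: ltP => h2; lra.
Qed.

End approx.

(** The tangent bound [1 + x <= expR x] at [x = g - ln (p / (q r))], multiplied by [p]; equality
    holds at the log-likelihood ratio. The last hypothesis expresses absolute continuity and keeps
    the quotient meaningful. *)
Lemma mi_term_ge {R : realType} (p q r g : R) : 0 <= p -> 0 <= q -> 0 <= r ->
  (0 < p -> 0 < q * r) ->
  p * g + p - q * r * expR g <= mi_term p q r.
Proof.
move=> p0 q0 r0 pqr; rewrite /mi_term; case: eqP => [->|/eqP pN0].
  by rewrite mul0r !add0r oppr_le0 !mulr_ge0// expR_ge0.
have {}p0 : 0 < p by rewrite lt_neqAle eq_sym pN0.
have Q0 := pqr p0.
have := ler_wpM2l (ltW p0) (expR_ge1Dx (- ln (p / (q * r)) + g)).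
rewrite expRD expRN lnK ?posrE ?divr_gt0// invf_div mulrA.
have -> : p * (q * r / p) = q * r by rewrite mulrC divfK.
lra.
Qed.

Section mutual_info_finite.
Context {R : realType} {L : nat}.
Local Notation V := (L.-tuple R).
Variables (PX : probability V R) (k : R.-pker V ~> V).
Variable J : probability (V * V)%type R.
Hypothesis JE : forall F : V * V -> R, measurable_fun [set: V * V] F ->
  (forall z, 0 <= F z) ->
  (\int[J]_z (F z)%:E = \int[PX]_x \int[k x]_y (F (x, y))%:E)%E.

Let rectE (A B : set V) z : \1_(A `*` B) z = \1_A z.1 * \1_B z.2 :> R.
Proof. by rewrite !indicE in_setX -natrM mulnb. Qed.

Lemma joint_law_rect A B : measurable A -> measurable B ->
  J (A `*` B) = joint_rect PX k A B.
Proof.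
move=> mA mB; have mAB : measurable (A `*` B) by exact: measurableX.
have mF : measurable_fun [set: V * V] (\1_(A `*` B) : V * V -> R) by [].
have F0 z : 0 <= \1_(A `*` B) z :> R by [].
have := JE mF F0.
rewrite integral_indic// setIT => ->.
rewrite /joint_rect [RHS]integral_mkcond; apply: eq_integral => x _.
rewrite patchE; case: ifPn => xA.
  transitivity (\int[k x]_y (\1_B y)%:E)%E; last by rewrite integral_indic// setIT.
  apply: eq_integral => y _.
  by rewrite rectE indicE/= xA mul1r.
by rewrite integral0_eq// => y _; rewrite rectE indicE/= (negPf xA) mul0r.
Qed.

Lemma joint_law_fst A : measurable A -> PX A = J (fst @^-1` A).
Proof.
move=> mA; have -> : fst @^-1` A = A `*` [set: V].
  by apply/seteqP; split => z /=; [|case].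
rewrite joint_law_rect// /joint_rect; under eq_integral do rewrite prob_kernel.
by rewrite integral_cst// mul1e.
Qed.

Lemma joint_law_snd B : measurable B -> out_law PX k B = J (snd @^-1` B).
Proof.
move=> mB; have -> : snd @^-1` B = [set: V] `*` B.
  by apply/seteqP; split => z /=; [|case].
by rewrite joint_law_rect.
Qed.

Let hI (D : set V) : measurable D -> has_integral PX (\1_D : V -> R) (fine (PX D)).
Proof.
move=> mD; apply: ge0_has_integral => //.
by rewrite integral_indic// setIT fineK// fin_num_measure.
Qed.

Let hJ A B : measurable A -> measurable B ->
  has_integral J (fun z => \1_A z.1 * \1_B z.2) (fine (joint_rect PX k A B)).
Proof.
move=> mA mB; have mAB : measurable (A `*` B) by exact: measurableX.
have mF : measurable_fun [set: V * V] (\1_(A `*` B) : V * V -> R) by [].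
have : has_integral J (\1_(A `*` B) : V * V -> R) (fine (J (A `*` B))).
  apply: ge0_has_integral => //.
  by rewrite integral_indic// setIT fineK// fin_num_measure.
by rewrite joint_law_rect//; apply: eq_has_integral.
Qed.

Variables (S1 S2 : finType) (alpha : V -> S1) (beta : V -> S2).
Hypotheses (malpha : forall a, measurable (alpha @^-1` [set a]))
  (mbeta : forall b, measurable (beta @^-1` [set b])).

Let fiber_partition (S : finType) (f : V -> S) :
  (forall a, measurable (f @^-1` [set a])) ->
  is_partition (fun i : 'I_#|S| => f @^-1` [set enum_val i]).
Proof.
move=> mf; split => [//|i j ij|x].
  apply/seteqP; split => x //= [-> /enum_val_inj] /eqP.
  by rewrite (negPf ij).
by exists (enum_rank (f x)) => /=; rewrite enum_rankK.
Qed.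

Let sum_fiber (S : finType) (f : V -> S) (g : S -> R) x :
  \sum_a g a * \1_(f @^-1` [set a]) x = g (f x).
Proof.
rewrite (bigD1 (f x))//= indicE mem_set// mulr1 big1 ?addr0// => a ax.
by rewrite indicE memNset ?mulr0//= => fa; rewrite fa eqxx in ax.
Qed.

Lemma sum_out_law_fiber :
  \sum_b fine (out_law PX k (beta @^-1` [set b])) = 1.
Proof.
have hr b : has_integral J (fun z => \1_(beta @^-1` [set b]) z.2)
    (fine (out_law PX k (beta @^-1` [set b]))).
  have := hJ measurableT (mbeta b); apply: eq_has_integral => // z.
  by rewrite indicT mul1r.
apply: (has_integral_unique _ (has_integral_cst J 1)).
apply: eq_has_integral (has_integral_sum (index_enum S2) hr) => // z.
by have := sum_fiber beta (fun=> 1) z.2; under eq_bigr do rewrite mul1r.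
Qed.

(** The linearised Donsker-Varadhan bound for a test function of finitely many values: the fibres of
    [alpha] and [beta] form the partitions, and [mi_term_ge] is summed over their cells. *)
Lemma mutual_info_ge_finite (g : S1 -> S2 -> R) v (w : S2 -> R) :
  has_integral J (fun z => g (alpha z.1) (beta z.2)) v ->
  (forall b, has_integral PX (fun x => expR (g (alpha x) b)) (w b)) ->
  ((v + 1 - \sum_b fine (out_law PX k (beta @^-1` [set b])) * w b)%:E <=
    mutual_info PX k)%E.
Proof.
move=> hv hw.
pose A a := alpha @^-1` [set a]; pose B b := beta @^-1` [set b].
pose p a b := fine (joint_rect PX k (A a) (B b)).
pose q a := fine (PX (A a)); pose r b := fine (out_law PX k (B b)).
have hp a b : has_integral J (fun z => \1_(A a) z.1 * \1_(B b) z.2) (p a b).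
  by apply: hJ; [exact: malpha|exact: mbeta].
have hq a : has_integral PX (\1_(A a) : V -> R) (q a) by apply: hI; exact: malpha.
have hr b : has_integral J (fun z => \1_(B b) z.2) (r b).
  have := hJ measurableT (mbeta b); apply: eq_has_integral => // z.
  by rewrite indicT mul1r.
have vE : v = \sum_a \sum_b g a b * p a b.
  apply: (has_integral_unique hv).
  have := has_integral_sum (index_enum S1) (fun a =>
    has_integral_sum (index_enum S2) (fun b => has_integralZ (g a b) (hp a b))).
  apply: eq_has_integral => // z.
  rewrite -(sum_fiber beta (g (alpha z.1)) z.2).
  rewrite -(sum_fiber alpha (fun a => \sum_b g a b * \1_(B b) z.2) z.1).
  apply: eq_bigr => a _; rewrite mulr_suml; apply: eq_bigr => b _.
  by rewrite mulrA mulrAC.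
have pE : 1 = \sum_a \sum_b p a b.
  apply: (has_integral_unique (has_integral_cst J 1)).
  have := has_integral_sum (index_enum S1) (fun a =>
    has_integral_sum (index_enum S2) (hp a)).
  apply: eq_has_integral => // z; under eq_bigr do rewrite -mulr_sumr.
  rewrite -mulr_suml.
  have := sum_fiber alpha (fun=> 1) z.1; under eq_bigr do rewrite mul1r; move=> ->.
  by have := sum_fiber beta (fun=> 1) z.2; under eq_bigr do rewrite mul1r; move=> ->; rewrite mulr1.
have wE b : w b = \sum_a expR (g a b) * q a.
  apply: (has_integral_unique (hw b)).
  have := has_integral_sum (index_enum S1) (fun a => has_integralZ (expR (g a b)) (hq a)).
  apply: eq_has_integral => // x.
  exact: (sum_fiber alpha (fun a => expR (g a b))).
have p0 a b : 0 <= p a b.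
  by apply: (le_has_integral (has_integral0 J) (hp a b)) => z; rewrite mulr_ge0.
have q0 a : 0 <= q a.
  by apply: (le_has_integral (has_integral0 PX) (hq a)) => z.
have r0 b : 0 <= r b.
  by apply: (le_has_integral (has_integral0 J) (hr b)) => z.
have hq' a : has_integral J (fun z => \1_(A a) z.1) (q a).
  exact: (has_integral_law measurable_fst joint_law_fst (hq a)).
have pq a b : p a b <= q a.
  apply: (le_has_integral (hp a b) (hq' a)) => z.
  by rewrite ler_piMr// indicE lern1 leq_b1.
have pr a b : p a b <= r b.
  apply: (le_has_integral (hp a b) (hr b)) => z.
  by rewrite ler_piMl// indicE lern1 leq_b1.
apply: (@le_trans _ _ (\sum_a \sum_b mi_term (p a b) (q a) (r b))%:E).
  rewrite lee_fin vE [X in _ + X - _]pE.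
  under [X in _ - X]eq_bigr do rewrite wE mulr_sumr.
  rewrite [X in _ - X]exchange_big/= -big_split/= -sumrB; apply: ler_sum => a _.
  rewrite -big_split/= -sumrB; apply: ler_sum => b _.
  apply: le_trans (mi_term_ge (g a b) (p0 a b) (q0 a) (r0 b) _).
    by rewrite -/(r b); lra.
  (* A joint cell weighs at most as much as either of its marginal cells. *)
  by move=> ppos; rewrite mulr_gt0// (lt_le_trans ppos).
apply: ereal_sup_ubound; exists #|S1|, #|S2|.
exists (fun i => A (enum_val i)), (fun j => B (enum_val j)); split.
- exact: fiber_partition.
- exact: fiber_partition.
congr EFin; rewrite (reindex (fun i : 'I_#|S1| => enum_val i))/=; last first.
  by exists enum_rank => i _; rewrite ?enum_valK ?enum_rankK.
apply: eq_bigr => i _.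
rewrite (reindex (fun i : 'I_#|S2| => enum_val i))//=.
by exists enum_rank => j _; rewrite ?enum_valK ?enum_rankK.
Qed.

End mutual_info_finite.

(** Quadratic growth lets the second moments of the coordinates dominate all quantised test
    functions at once. *)
Lemma mehler_growth {R : realType} (r : R) : `|r| < 1 ->
  exists K, forall a b, `|mehler r a b| <= K * (1 + a ^+ 2 + b ^+ 2).
Proof.
move=> r1; have g0 := subr1_sqr_gt0 r1.
set g := 1 - r ^+ 2 in g0.
exists (2^-1 + g^-1 + `|ln g| / 2) => a b.
have gi0 : 0 < g^-1 by rewrite invr_gt0.
have sq : (a - r * b) ^+ 2 / (2 * g) <= (a ^+ 2 + b ^+ 2) * g^-1.
  rewrite invfM mulrA ler_pM2r//.
  have : r ^+ 2 <= 1 by rewrite -subr_ge0 ltW.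
  have := sqr_ge0 (a + r * b); have := sqr_ge0 b; nra.
have sq0 : 0 <= (a - r * b) ^+ 2 / (2 * g).
  by rewrite divr_ge0 ?sqr_ge0// mulr_ge0// ltW.
have a0 := sqr_ge0 a; have b0 := sqr_ge0 b.
rewrite /mehler -/g.
have lng : `|ln g / 2| = `|ln g| / 2 by rewrite normrM [X in _ * X]ger0_norm.
have -> : (2^-1 + g^-1 + `|ln g| / 2) * (1 + a ^+ 2 + b ^+ 2) =
  2^-1 * (1 + a ^+ 2 + b ^+ 2) + (a ^+ 2 + b ^+ 2) * g^-1 + g^-1 +
  `|ln g| / 2 + `|ln g| / 2 * (a ^+ 2 + b ^+ 2) by ring.
have c0 : 0 <= `|ln g| / 2 * (a ^+ 2 + b ^+ 2).
  by rewrite mulr_ge0 ?divr_ge0 ?addr_ge0.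
move: lng => <- in c0 *.
rewrite (le_trans (ler_normB _ _))//.
have : `|a ^+ 2 / 2 - (a - r * b) ^+ 2 / (2 * g)| <=
    a ^+ 2 / 2 + (a - r * b) ^+ 2 / (2 * g).
  by rewrite (le_trans (ler_normB _ _))// !ger0_norm// divr_ge0.
lra.
Qed.

(** After exchanging the arguments, [a] occurs only in a negative square. A bound free of [a] makes
    the exponential bounded for fixed [b]. *)
Lemma mehler_le {R : realType} (r a b : R) : `|r| < 1 ->
  mehler r a b <= b ^+ 2 / 2 - ln (1 - r ^+ 2) / 2.
Proof.
move=> r1; rewrite mehlerC// /mehler lerD2r gerBl.
by rewrite divr_ge0 ?sqr_ge0// mulr_ge0// ltW// subr1_sqr_gt0.
Qed.

Lemma cvg_mehler {R : realType} (r : R) (a_ : nat -> R) (a b : R) :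
  a_ n @[n --> \oo] --> a -> mehler r (a_ n) b @[n --> \oo] --> mehler r a b.
Proof.
move=> ca; rewrite /mehler; apply: cvgB; last exact: cvg_cst.
have cX (f : nat -> R) (l : R) : f n @[n --> \oo] --> l -> f n ^+ 2 @[n --> \oo] --> l ^+ 2.
  by move=> cf; rewrite expr2; under eq_fun do rewrite expr2; exact: cvgM.
apply: cvgB; apply: cvgM; try exact: cvg_cst; apply: cX => //.
by apply: cvgB => //; exact: cvg_cst.
Qed.

Lemma cvg_sumr {R : realType} {T : Type} (F : set_system T) (FF : Filter F)
    I (s : seq I) (f : I -> T -> R) (l : I -> R) :
  (forall i, f i x @[x --> F] --> l i) ->
  \sum_(i <- s) f i x @[x --> F] --> \sum_(i <- s) l i.
Proof.
move=> cf; elim: s => [|i s ih].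
  by rewrite big_nil; under eq_fun do rewrite big_nil; exact: cvg_cst.
by rewrite big_cons; under eq_fun do rewrite big_cons; exact: cvgD.
Qed.

(** * The Gaussian lower bound on the information of a channel *)

Section converse.
Context {R : realType} {L : nat} (Theta : 'M[R]_L) (lam : 'I_L -> R).
Context (PX : probability (L.-tuple R) R).
Hypotheses (ThetaK : Theta^T *m Theta = 1%:M) (lam0 : forall l, 0 < lam l).
Hypothesis gPX : gaussian_law PX (covmx Theta lam).
Local Notation V := (L.-tuple R).
Local Notation u := (whiten Theta lam).
Variables (k : R.-pker V ~> V) (J : probability (V * V)%type R).
Hypothesis JE : forall F : V * V -> R, measurable_fun [set: V * V] F ->
  (forall z, 0 <= F z) ->
  (\int[J]_z (F z)%:E = \int[PX]_x \int[k x]_y (F (x, y))%:E)%E.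

Let gu := whiten_standard_gaussian ThetaK lam0 gPX.

Let mu l : measurable_fun [set: V] (u l). Proof. exact: measurable_whiten. Qed.

Let hu l : has_integral J (fun z => u l z.1 ^+ 2) 1.
Proof.
exact: (has_integral_law measurable_fst (joint_law_fst JE)
  (whiten_second_moment ThetaK lam0 gPX l)).
Qed.

Section mehler_bound.
Variables (r : 'I_L -> R) (v : 'I_L -> V -> R) (tau : 'I_L -> R) (Z : R).
Hypotheses (r1 : forall l, `|r l| < 1) (mv : forall l, measurable_fun [set: V] (v l)).
Hypothesis hv : forall l, has_integral J (fun z => v l z.2 ^+ 2) (tau l).
Hypothesis hZ :
  has_integral J (fun z => \sum_l mehler (r l) (u l z.1) (v l z.2)) Z.

Let measurable_quantized (q : R -> R) (s : seq R) (f : 'I_L -> V -> R)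
    (qs : forall t, q t \in s) (a : {ffun 'I_L -> seq_sub s}) :
  measurable_fun [set: R] q -> (forall l, measurable_fun [set: V] (f l)) ->
  measurable ((fun x => [ffun l => SeqSub (qs (f l x))]) @^-1` [set a]).
Proof.
move=> mq mf.
rewrite (_ : _ @^-1` _ = \bigcap_(l in [set: 'I_L])
    ((q \o f l) @^-1` [set ssval (a l)])).
  apply: fin_bigcap_measurable => [|l _]; first exact: finite_finset.
  rewrite -[X in measurable X]setTI.
  by apply: (measurableT_comp mq (mf l)) => //; exact: measurable_set1.
apply/seteqP; split => x /=.
  by move=> ax l _ /=; rewrite -ax ffunE.
by move=> H; apply/ffunP => l; rewrite ffunE; apply/val_inj; exact: H.
Qed.

(* Quantise [u(x)] and [v(y)]. For a quantised [v] the exponential moment is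
   finite and converges to [1] as the quantisation of [u] is refined; then the
   quantisation of [v] is refined. *)
Lemma mutual_info_ge_mehler : (Z%:E <= mutual_info PX k)%E.
Proof.
have [q [s [mq qs q2 cq]]] := @measurable_approx_finite R.
have [K KP] : exists K : 'I_L -> R, forall l a b,
    `|mehler (r l) a b| <= K l * (1 + a ^+ 2 + b ^+ 2).
  have H l := mehler_growth (r1 l).
  by have [K KP] := choice H; exists K.
have K0 l : 0 <= K l.
  by have := KP l 0 0; rewrite expr0n/= !addr0 mulr1; exact: le_trans.
have mu1 l : measurable_fun [set: V * V] (fun z => u l z.1) by exact: measurableT_comp.
have mv2 l : measurable_fun [set: V * V] (fun z => v l z.2) by exact: measurableT_comp.
have hdom := has_integral_sum (index_enum 'I_L) (fun l =>
  has_integralZ (K l) (has_integralD (has_integralD (has_integral_cst J 1) (hu l)) (hv l))).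
set dom := (X in has_integral J X) in hdom.
have domP (a b : 'I_L -> R) z : (forall l, a l ^+ 2 <= u l z.1 ^+ 2) ->
    (forall l, b l ^+ 2 <= v l z.2 ^+ 2) -> `|\sum_l mehler (r l) (a l) (b l)| <= dom z.
  move=> au bv; apply: le_trans (ler_norm_sum _ _ _) _; apply: ler_sum => l _.
  by rewrite (le_trans (KP l _ _))// ler_wpM2l// !lerD.
pose G m n z := \sum_l mehler (r l) (q m (u l z.1)) (q n (v l z.2)).
pose G' n z := \sum_l mehler (r l) (u l z.1) (q n (v l z.2)).
have hG m n : has_integral J (G m n) (\int[J]_z G m n z).
  apply: (has_integral_dom _ hdom) => [|z]; last exact: domP.
  by apply: measurable_sum => l; apply: measurable_mehler; exact: measurableT_comp.
have hG' n : has_integral J (G' n) (\int[J]_z G' n z).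
  apply: (has_integral_dom _ hdom) => [|z]; last exact: domP.
  by apply: measurable_sum => l; apply: measurable_mehler => //; exact: measurableT_comp.
have GG' n : \int[J]_z G m n z @[m --> \oo] --> \int[J]_z G' n z.
  apply: (has_integral_cvg (hG ^~ n) (hG' n) hdom) => [m z|z]; first exact: domP.
  by apply: cvg_sumr => l; exact: cvg_mehler.
have G'Z : \int[J]_z G' n z @[n --> \oo] --> Z.
  apply: (has_integral_cvg hG' hZ hdom) => [n z|z]; first exact: domP.
  apply: cvg_sumr => l; rewrite mehlerC//; under eq_fun do rewrite mehlerC//.
  exact: cvg_mehler.
pose w m (b : 'I_L -> R) :=
  \int[PX]_x expR (\sum_l mehler (r l) (q m (u l x)) (b l)).
(* The bound depends on [b] but not on [a]: inside the exponential [u] can be sent to its limit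
   while [v] stays quantised, hence the order of the two limits. *)
have wb b : exists C, forall a : 'I_L -> R, `|expR (\sum_l mehler (r l) (a l) (b l))| <= C.
  exists (expR (\sum_l (b l ^+ 2 / 2 - ln (1 - r l ^+ 2) / 2))) => a.
  by rewrite ger0_norm ?expR_ge0// ler_expR; apply: ler_sum => l _; exact: mehler_le.
have hw m b : has_integral PX
    (fun x => expR (\sum_l mehler (r l) (q m (u l x)) (b l))) (w m b).
  have [C CP] := wb b; apply: (@bounded_has_integral _ _ _ _ _ C) => [|x]; last first.
    exact: (CP (fun l => q m (u l x))).
  apply: measurableT_comp => //; apply: measurable_sum => l.
  by apply: measurable_mehler => //; exact: measurableT_comp.
have w1 b : w m b @[m --> \oo] --> (1 : R).
  have [C CP] := wb b.
  apply: (has_integral_cvg (hw ^~ b) (has_integral_mehler gu b r1)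
    (has_integral_cst PX C)) => [m x|x]; first exact: (CP (fun l => q m (u l x))).
  have cS : \sum_l mehler (r l) (q m (u l x)) (b l) @[m --> \oo] -->
      \sum_l mehler (r l) (u l x) (b l).
    by apply: cvg_sumr => l; exact: cvg_mehler.
  exact: (cvg_comp _ _ cS (@continuous_expR R _)).
pose al m x : {ffun 'I_L -> seq_sub (s m)} := [ffun l => SeqSub (qs m (u l x))].
pose be n y : {ffun 'I_L -> seq_sub (s n)} := [ffun l => SeqSub (qs n (v l y))].
have mal m a : measurable (al m @^-1` [set a]) by exact: measurable_quantized.
have mbe n b : measurable (be n @^-1` [set b]) by exact: measurable_quantized.
pose rr n b := fine (out_law PX k (be n @^-1` [set b])).
have rr1 n : \sum_b rr n b = 1 by exact: (sum_out_law_fiber JE (mbe n)).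
have bound m n : ((\int[J]_z G m n z + 1 -
    \sum_b rr n b * w m (fun l => ssval (b l)))%:E <= mutual_info PX k)%E.
  apply: (@mutual_info_ge_finite _ _ PX k J JE _ _ (al m) (be n) (mal m) (mbe n)
    (fun a b => \sum_l mehler (r l) (ssval (a l)) (ssval (b l)))).
    apply: eq_has_integral (hG m n) => // z.
    by apply: eq_bigr => l _; rewrite !ffunE.
  move=> b; apply: eq_has_integral (hw m (fun l => ssval (b l))) => // x.
  by congr expR; apply: eq_bigr => l _; rewrite !ffunE.
case: (mutual_info PX k) bound => [i| |] bound; last 2 first.
- exact: leey.
- by have := bound 0%N 0%N; rewrite leeNy_eq.
rewrite lee_fin; apply: (cvgr_to_le G'Z); apply: nearW => n.
(* For fixed [n] the sum over [b] is finite and its weights add up to 1, so the correction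
   [1 - \sum_b] tends to 0 in [m]. *)
have cvgm : \int[J]_z G m n z + 1 - \sum_b rr n b * w m (fun l => ssval (b l))
    @[m --> \oo] --> \int[J]_z G' n z + 1 - \sum_b rr n b * 1.
  apply: cvgB; first by apply: cvgD => //; exact: cvg_cst.
  by apply: cvg_sumr => b; apply: cvgM; [exact: cvg_cst|exact: w1].
have -> : \int[J]_z G' n z = \int[J]_z G' n z + 1 - \sum_b rr n b * 1.
  by rewrite -mulr_suml rr1 mul1r addrK.
by apply: (cvgr_to_le cvgm); apply: nearW => m; rewrite -lee_fin.
Qed.

End mehler_bound.

Let mrot1 l : measurable_fun [set: V * V] (fun z => rot Theta z.1 l).
Proof. exact: (measurableT_comp (measurable_rot Theta l) measurable_fst). Qed.

Let mrot2 l : measurable_fun [set: V * V] (fun z => rot Theta z.2 l).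
Proof. exact: (measurableT_comp (measurable_rot Theta l) measurable_snd). Qed.

Let rotE x l : rot Theta x l = Num.sqrt (lam l) * u l x.
Proof. by rewrite mulrC divfK// gt_eqF// sqrtr_gt0. Qed.

Let rot_second_moment l : has_integral PX (fun x => rot Theta x l ^+ 2) (lam l).
Proof.
apply: eq_has_integral (has_integralZ (lam l)
  (whiten_second_moment ThetaK lam0 gPX l)) => [x|]; last by rewrite mulr1.
by rewrite rotE [RHS]exprMn sqr_sqrtr// ltW.
Qed.

Let finite_sqdist (G : probability (V * V)%type R) (c : R) :
  (\int[G]_z (sqdist z.1 z.2)%:E <= c%:E)%E ->
  exists2 delta, delta <= c & has_integral G (fun z => sqdist z.1 z.2) delta.
Proof.
move=> hc; have i0 : (0 <= \int[G]_z (sqdist z.1 z.2)%:E)%E.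
  by apply: integral_ge0 => z _; rewrite lee_fin sqdist_ge0.
have ifin : (\int[G]_z (sqdist z.1 z.2)%:E)%E \is a fin_num.
  by rewrite ge0_fin_numE// (le_lt_trans hc)// ltry.
exists (fine (\int[G]_z (sqdist z.1 z.2)%:E)); first by rewrite -lee_fin fineK.
apply: ge0_has_integral; [exact: measurable_sqdist|by move=> z; exact: sqdist_ge0|].
by rewrite fineK.
Qed.

Variables (D Q i : R).
Hypotheses (hD : (exp_distortion PX k <= D%:E)%E)
  (hQ : (W2sq PX (out_law PX k) <= Q%:E)%E)
  (hi : (mutual_info PX k <= i%:E)%E).

Let hdelta : exists2 delta, delta <= D &
  has_integral J (fun z => sqdist z.1 z.2) delta.
Proof.
apply: finite_sqdist; rewrite JE//; first exact: measurable_sqdist.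
by move=> z; exact: sqdist_ge0.
Qed.

Let tau l := \int[J]_z (rot Theta z.2 l ^+ 2).

Let hz l : has_integral J (fun z => rot Theta z.1 l ^+ 2) (lam l).
Proof.
exact: (has_integral_law measurable_fst (joint_law_fst JE) (rot_second_moment l)).
Qed.

(** Finite because the distortion is: [w^2 <= 2 z^2 + 2 (z - w)^2], the difference of the two sides
    being [(w - 2 z)^2]. *)
Let htau l : has_integral J (fun z => rot Theta z.2 l ^+ 2) (tau l).
Proof.
have [delta _ hd] := hdelta.
have H := has_integralD (has_integralZ 2 (hz l)) (has_integralZ 2 hd).
apply: (has_integral_dom _ H) => [|z]; first exact: measurable_funX.
rewrite ger0_norm ?sqr_ge0// (sqdist_rot ThetaK) (bigD1 l)//=.
have : 0 <= \sum_(j < L | j != l) (rot Theta z.1 j - rot Theta z.2 j) ^+ 2.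
  by apply: sumr_ge0 => j _; exact: sqr_ge0.
by have := sqr_ge0 (rot Theta z.2 l - 2 * rot Theta z.1 l); nra.
Qed.

Let tau0 l : 0 <= tau l.
Proof.
by apply: (le_has_integral (has_integral0 J) (htau l)) => z; exact: sqr_ge0.
Qed.

Let B l := \int[J]_z (rot Theta z.1 l * rot Theta z.2 l).

Let hB l : has_integral J (fun z => rot Theta z.1 l * rot Theta z.2 l) (B l).
Proof. exact: has_integralM (mrot1 l) (mrot2 l) (hz l) (htau l). Qed.

Let B2 l : B l ^+ 2 <= lam l * tau l.
Proof. exact: (@cauchy_schwarz _ _ _ J _ _ _ _ (hz l) (htau l) _ (hB l)). Qed.

(** For [tau l = 0] the division by zero yields [rho l = 0], the right convention: then [B l = 0] by
    Cauchy-Schwarz and [rho2] still holds. *)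
Let rho l := B l / (Num.sqrt (lam l) * Num.sqrt (tau l)).

Let rho2 l : lam l * tau l * rho l ^+ 2 = B l ^+ 2.
Proof.
rewrite /rho expr_div_n exprMn !sqr_sqrtr// ?(ltW (lam0 l))//.
have [t0|tN0] := eqVneq (tau l) 0; last by rewrite mulrC divfK// mulf_neq0// gt_eqF.
by have := B2 l; rewrite t0 !mulr0 mul0r => h; apply/eqP; rewrite eq_le h sqr_ge0.
Qed.

Let rho_le1 l : rho l ^+ 2 <= 1.
Proof.
have [t0|tN0] := eqVneq (tau l) 0.
  by rewrite /rho t0 sqrtr0 mulr0 invr0 mulr0 expr0n.
have lt0 : 0 < lam l * tau l by rewrite mulr_gt0// lt_neqAle eq_sym tN0 tau0.
by rewrite -(ler_pM2l lt0) mulr1 rho2; exact: B2.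
Qed.

Let v l (y : V) := rot Theta y l / Num.sqrt (tau l).

Let mv l : measurable_fun [set: V] (v l).
Proof. by apply: measurable_funM => //; exact: measurable_rot. Qed.

Let hv l : has_integral J (fun z => v l z.2 ^+ 2) (tau l != 0)%:R.
Proof.
apply: eq_has_integral (has_integralZ (tau l)^-1 (htau l)) => [z|].
  by rewrite /v expr_div_n sqr_sqrtr// mulrC.
by have [->|tN0] := eqVneq (tau l) 0; rewrite ?mulr0// mulVf.
Qed.

Let huv l : has_integral J (fun z => u l z.1 * v l z.2) (rho l).
Proof.
apply: eq_has_integral (has_integralZ (Num.sqrt (lam l) * Num.sqrt (tau l))^-1 (hB l)) => [z|].
  by rewrite /v /whiten invfM; ring.
by rewrite mulrC.
Qed.

Let rho_tau0 l : tau l = 0 -> rho l = 0.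
Proof. by move=> t0; rewrite /rho t0 sqrtr0 mulr0 invr0 mulr0. Qed.

(* With correlation [theta rho] the excess over [- ln (1 - theta^2 rho^2) / 2] is
   [theta (1 - theta) rho^2 / (1 - theta^2 rho^2)]. *)
Let sum_ln_le theta : 0 <= theta <= 1 -> (forall l, `|theta * rho l| < 1) ->
  2^-1 * \sum_l - ln (1 - (theta * rho l) ^+ 2) <= i.
Proof.
move=> /andP[t0 t1] r1.
have H l := has_integralB (has_integralB (has_integralZ 2^-1 (hu l))
  (has_integralZ (2 * (1 - (theta * rho l) ^+ 2))^-1
    (has_integralD (has_integralB (hu l) (has_integralZ (2 * (theta * rho l)) (huv l)))
      (has_integralZ ((theta * rho l) ^+ 2) (hv l)))))
  (has_integral_cst J (ln (1 - (theta * rho l) ^+ 2) / 2)).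
have := has_integral_sum (index_enum 'I_L) H.
set Z := (X in has_integral J _ X); move=> hZ.
have : (Z%:E <= mutual_info PX k)%E.
  apply: (mutual_info_ge_mehler r1 mv hv).
  apply: eq_has_integral hZ => // z; apply: eq_bigr => l _.
  have g0 := subr1_sqr_gt0 (r1 l).
  rewrite /mehler; set g := 1 - _ in g0 *.
  by field; rewrite gt_eqF.
move=> /le_trans /(_ hi); rewrite lee_fin; apply: le_trans.
rewrite mulr_sumr; apply: ler_sum => l _.
have g0 := subr1_sqr_gt0 (r1 l).
have -> : (theta * rho l) ^+ 2 * (tau l != 0)%:R = (theta * rho l) ^+ 2.
  by have [/rho_tau0 ->|_] := eqVneq (tau l) 0; rewrite /= ?mulr0 ?mulr1 ?expr0n.
have -> : 2^-1 * 1 - (2 * (1 - (theta * rho l) ^+ 2))^-1 *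
    (1 - 2 * (theta * rho l) * rho l + (theta * rho l) ^+ 2) -
    ln (1 - (theta * rho l) ^+ 2) / 2 =
  2^-1 * - ln (1 - (theta * rho l) ^+ 2) +
    theta * (1 - theta) * rho l ^+ 2 / (1 - (theta * rho l) ^+ 2).
  by field; rewrite gt_eqF.
rewrite lerDl; apply: divr_ge0; last exact: ltW.
by apply: mulr_ge0; [rewrite mulr_ge0// subr_ge0|exact: sqr_ge0].
Qed.

Let i0 : 0 <= i.
Proof.
have z1 l : `|0 * rho l| < 1 by rewrite mul0r normr0.
have := sum_ln_le _ z1; rewrite lexx ler01 => /(_ isT).
by rewrite big1 ?mulr0// => l _; rewrite mul0r expr0n subr0 ln1 oppr0.
Qed.

(** A correlation of modulus 1 would make the bound [sum_ln_le] exceed [i] as [theta] approaches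
    1. *)
Let rho_lt1 l : `|rho l| < 1.
Proof.
rewrite -sqrtr_sqr -[ltRHS]sqrtr1 ltr_sqrt// lt_neqAle rho_le1 andbT.
apply/negP => /eqP r1.
(* With [1 - theta^2 = e] the [l]-th term alone contributes [i + 1]; the others are nonnegative. *)
pose e := expR (- (2 * i + 2)).
have e0 : 0 < e by exact: expR_gt0.
have e1 : e <= 1 by rewrite -[leRHS]expR0 ler_expR; have := i0; lra.
pose theta := Num.sqrt (1 - e).
have th2 : theta ^+ 2 = 1 - e by rewrite sqr_sqrtr// subr_ge0.
have th0 : 0 <= theta by exact: sqrtr_ge0.
have th1 : theta < 1 by nra.
have thr j : (theta * rho j) ^+ 2 <= 1 - e.
  by rewrite exprMn th2 ler_piMr// ?rho_le1// subr_ge0.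
have thr1 j : `|theta * rho j| < 1.
  rewrite -sqrtr_sqr -[ltRHS]sqrtr1 ltr_sqrt//.
  by apply: le_lt_trans (thr j) _; rewrite gtrBl.
have := sum_ln_le _ thr1; rewrite th0 ltW//= => /(_ isT).
rewrite (bigD1 l)//= exprMn r1 mulr1 th2 opprB addrCA subrr addr0 expRK.
have : 0 <= \sum_(j < L | j != l) - ln (1 - (theta * rho j) ^+ 2).
  apply: sumr_ge0 => j _; rewrite oppr_ge0 ln_le0// gerBl sqr_ge0 //.
by lra.
Qed.

Lemma converse_feasible : exists lamh gam, rdp_feasible lam D Q lamh gam /\
  rdp_objective lam gam <= i.
Proof.
exists tau, (fun l => lam l * (1 - rho l ^+ 2)); split; last first.
  rewrite /rdp_objective.
  have o1 l : `|1 * rho l| < 1 by rewrite mul1r.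
  have := sum_ln_le _ o1; rewrite ler01 lexx => /(_ isT).
  rewrite (eq_bigr (fun l => ln (lam l / (lam l * (1 - rho l ^+ 2)))))// => l _.
  rewrite mul1r invfM mulVKf ?gt_eqF// lnV// posrE.
  exact: subr1_sqr_gt0.
split => [l|//||].
- have g0 := subr1_sqr_gt0 (rho_lt1 l).
  by rewrite mulr_gt0//= ger_pMr// gerBl sqr_ge0.
(* The square root in the constraint equals [|B l|], which is at least the actual cross moment
   [B l], so the distortion of the program does not exceed that of the channel. *)
- have [delta deltaD hd] := hdelta; apply: le_trans deltaD.
  have H l := has_integralD (has_integralB (hz l) (has_integralZ 2 (hB l))) (htau l).
  have dE : delta = \sum_l (lam l - 2 * B l + tau l).
    apply: (has_integral_unique hd).
    apply: eq_has_integral (has_integral_sum (index_enum 'I_L) H) => // z.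
    by rewrite (sqdist_rot ThetaK); apply: eq_bigr => l _; ring.
  rewrite dE; apply: ler_sum => l _; rewrite lerD2r lerD2l lerN2 ler_pM2l//.
  have -> : tau l * (lam l - lam l * (1 - rho l ^+ 2)) = B l ^+ 2.
    by rewrite -rho2; ring.
  by rewrite sqrtr_sqr ler_norm.
rewrite -lee_fin; apply: le_trans hQ; apply: le_ereal_inf_tmp => _ [G [G1 G2] <-].
have [->|Gfin] := eqVneq (\int[G]_z (sqdist z.1 z.2)%:E)%E +oo%E; first exact: leey.
have [delta _ hd] : exists2 delta, delta <= fine (\int[G]_z (sqdist z.1 z.2)%:E) &
    has_integral G (fun z => sqdist z.1 z.2) delta.
  apply: finite_sqdist; rewrite fineK// ge0_fin_numE ?ltey//.
  by apply: integral_ge0 => z _; rewrite lee_fin sqdist_ge0.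
rewrite (has_integralE hd) lee_fin.
have hGz l : has_integral G (fun z => rot Theta z.1 l ^+ 2) (lam l).
  apply: (has_integral_law measurable_fst _ (rot_second_moment l)) => U mU.
  apply: etrans (esym (G1 U mU)) _.
  by congr (G _); apply/seteqP; split => z /=; [case|].
(* The second marginals of [G] and [J] agree as set functions on measurable sets; both integrals are
   moved to [nu], the image of [J] under [snd]. *)
have hGw l : has_integral G (fun z => rot Theta z.2 l ^+ 2) (tau l).
  have m2 : measurable_fun [set: V] (fun y => rot Theta y l ^+ 2).
    by apply: measurable_funX; exact: measurable_rot.
  have [nu nuE] := probability_law J (@measurable_snd _ _ V V).
  apply: ge0_has_integral; [exact: measurable_funX|by move=> z; exact: sqr_ge0|].
  rewrite -(has_integralE (htau l)).
  rewrite -(@ge0_integral_law _ _ _ _ _ J nu snd measurable_snd (fun U _ => nuE U)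
    (fun y => rot Theta y l ^+ 2) m2 (fun y => sqr_ge0 _)).
  rewrite -(@ge0_integral_law _ _ _ _ _ G nu snd measurable_snd _
    (fun y => rot Theta y l ^+ 2) m2 (fun y => sqr_ge0 _))//.
  move=> U mU; apply: etrans (nuE U) _.
  apply: etrans (esym (joint_law_snd JE mU)) _; apply: etrans (esym (G2 U mU)) _.
  by congr (G _); apply/seteqP; split => z /=; [case|].
pose C l := \int[G]_z (rot Theta z.1 l * rot Theta z.2 l).
have hC l : has_integral G (fun z => rot Theta z.1 l * rot Theta z.2 l) (C l).
  exact: has_integralM (mrot1 l) (mrot2 l) (hGz l) (hGw l).
have C2 l : C l <= Num.sqrt (lam l) * Num.sqrt (tau l).
  have := @cauchy_schwarz _ _ _ G _ _ _ _ (hGz l) (hGw l) _ (hC l).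
  rewrite -sqrtrM ?(ltW (lam0 l))// => h; apply: le_trans (ler_norm _) _.
  by rewrite -sqrtr_sqr ler_wsqrtr.
have H l := has_integralD (has_integralB (hGz l) (has_integralZ 2 (hC l))) (hGw l).
have -> : delta = \sum_l (lam l - 2 * C l + tau l).
  apply: (has_integral_unique hd).
  apply: eq_has_integral (has_integral_sum (index_enum 'I_L) H) => // z.
  by rewrite (sqdist_rot ThetaK); apply: eq_bigr => l _; ring.
apply: ler_sum => l _.
rewrite sqrrB (sqr_sqrtr (ltW (lam0 l))) (sqr_sqrtr (tau0 l)).
by rewrite lerD2r lerD2l lerN2 mulr_natl; have := C2 l; lra.
Qed.

End converse.

(** * The optimisation problem *)

Lemma rdp_rate_ge0 {R : realType} {L : nat} (lam gam : 'I_L -> R) :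
  (forall l, 0 < gam l <= lam l) -> forall l, 0 <= ln (lam l / gam l).
Proof.
by move=> h l; have /andP[g0 gl] := h l; rewrite ln_ge0// ler_pdivlMr// mul1r.
Qed.

Section cvg_rdp.
Context {R : realType} {L : nat} (lam : 'I_L -> R).
Context {T : Type} {F : set_system T} {FF : Filter F}.
Variables (h g : T -> 'I_L -> R) (h0 g0 : 'I_L -> R).
Hypotheses (ch : forall l, h x l @[x --> F] --> h0 l)
  (cg : forall l, g x l @[x --> F] --> g0 l).

Let cvg_sqrtr (f : T -> R) (y : R) : f x @[x --> F] --> y ->
  Num.sqrt (f x) @[x --> F] --> Num.sqrt y.
Proof. by move=> cf; exact: (cvg_comp _ _ cf (@sqrt_continuous R _)). Qed.

Lemma cvg_rdp_distortion :
  \sum_l (lam l - 2 * Num.sqrt (h x l * (lam l - g x l)) + h x l) @[x --> F] -->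
  \sum_l (lam l - 2 * Num.sqrt (h0 l * (lam l - g0 l)) + h0 l).
Proof.
apply: cvg_sumr => l; apply: cvgD; last exact: ch.
apply: cvgB; first exact: cvg_cst.
apply: cvgM; first exact: cvg_cst.
apply: cvg_sqrtr; apply: cvgM; first exact: ch.
by apply: cvgB; [exact: cvg_cst|exact: cg].
Qed.

Lemma cvg_rdp_perception :
  \sum_l (Num.sqrt (lam l) - Num.sqrt (h x l)) ^+ 2 @[x --> F] -->
  \sum_l (Num.sqrt (lam l) - Num.sqrt (h0 l)) ^+ 2.
Proof.
apply: cvg_sumr => l.
have H : Num.sqrt (lam l) - Num.sqrt (h x l) @[x --> F] -->
    Num.sqrt (lam l) - Num.sqrt (h0 l).
  by apply: cvgB; [exact: cvg_cst|apply: cvg_sqrtr; exact: ch].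
by rewrite expr2; under eq_fun do rewrite expr2; exact: cvgM.
Qed.

Lemma cvg_rdp_objective : (forall l, 0 < lam l) -> (forall l, 0 < g0 l) ->
  rdp_objective lam (g x) @[x --> F] --> rdp_objective lam g0.
Proof.
move=> lam0 gpos; apply: cvgM; first exact: cvg_cst.
apply: cvg_sumr => l.
have H : lam l / g x l @[x --> F] --> lam l / g0 l.
  apply: cvgM; first exact: cvg_cst.
  by apply: cvgV; [rewrite gt_eqF|exact: cg].
by apply: (cvg_comp _ _ H); apply: continuous_ln; rewrite divr_gt0.
Qed.

End cvg_rdp.

Section minimum.
Context {R : realType} {L : nat} (lam : 'I_L -> R) (D P : R).
Hypothesis lam0 : forall l, 0 < lam l.

(** Both families become one point of a product of lines, [true] selecting [lamh] and [false]
    selecting [gam], so that Tychonoff's theorem makes the box compact. *)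
Let I := ('I_L * bool)%type.
Let T := prod_topology (fun _ : I => R).
Let lamh (f : T) (l : 'I_L) : R := f (l, true).
Let gam (f : T) (l : 'I_L) : R := f (l, false).

Let cvg_lamh (f : T) l : lamh g l @[g --> f] --> lamh f l.
Proof. exact: (@proj_continuous _ (fun _ : I => R) (l, true) f). Qed.

Let cvg_gam (f : T) l : gam g l @[g --> f] --> gam f l.
Proof. exact: (@proj_continuous _ (fun _ : I => R) (l, false) f). Qed.

Let dist (f : T) : R :=
  \sum_l (lam l - 2 * Num.sqrt (lamh f l * (lam l - gam f l)) + lamh f l).

Let perc (f : T) : R := \sum_l (Num.sqrt (lam l) - Num.sqrt (lamh f l)) ^+ 2.

Let cvg_dist (f : T) : dist g @[g --> f] --> dist f.
Proof. exact: cvg_rdp_distortion (@cvg_lamh f) (@cvg_gam f). Qed.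

Let cvg_perc (f : T) : perc g @[g --> f] --> perc f.
Proof. exact: cvg_rdp_perception (@cvg_lamh f). Qed.

Lemma rdp_minimum : (exists lamh gam, rdp_feasible lam D P lamh gam) ->
  exists lamh gam, rdp_feasible lam D P lamh gam /\
    forall lamh' gam', rdp_feasible lam D P lamh' gam' ->
      rdp_objective lam gam <= rdp_objective lam gam'.
Proof.
move=> [h0 [g0 feas0]].
pose c0 := rdp_objective lam g0.
(* Away from these bounds the constraints fail or the objective exceeds [c0]. *)
pose box (i : I) : set R := if i.2 then `[0, 2 * lam i.1 + 2 * P]%classic
  else `[lam i.1 * expR (- (2 * c0)), lam i.1]%classic.
pose K : set T := [set f | forall i, box i (f i)] `&` (dist @^-1` [set x | x <= D] `&`
  perc @^-1` [set x | x <= P]).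
have cK : compact K.
  apply: compact_closedI.
    apply: (@tychonoff _ (fun _ : I => R) box) => -[l []]; exact: segment_compact.
  by apply: closedI; (apply: preimage_closed; last exact: closed_le) => f _;
    [exact: cvg_dist|exact: cvg_perc].
have delta0 l : 0 < lam l * expR (- (2 * c0)) by rewrite mulr_gt0 ?expR_gt0.
have Kpos f l : K f -> 0 < gam f l.
  move=> [Kf _]; have := Kf (l, false); rewrite /box/= in_itv/= => /andP[h _].
  exact: lt_le_trans h.
have Kfeas f : K f -> rdp_feasible lam D P (lamh f) (gam f).
  move=> Kf; have [Kf1 [Kf2 Kf3]] := Kf; split => // l.
    have := Kf1 (l, false); rewrite /box/= in_itv/= => /andP[_ h].
    by rewrite Kpos.
  by have := Kf1 (l, true); rewrite /box/= in_itv/= => /andP[].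
have toK h g : rdp_feasible lam D P h g -> rdp_objective lam g <= c0 ->
    exists2 f, K f & lamh f = h /\ gam f = g.
  move=> feas gc; have [f1 f2 f3 f4] := feas.
  exists (fun i : I => if i.2 then h i.1 else g i.1) => //; split=> [|//].
  move=> [l []]; rewrite /box/= in_itv/=.
    rewrite f2/=.
    have : (Num.sqrt (lam l) - Num.sqrt (h l)) ^+ 2 <= P.
      apply: le_trans f4; rewrite (bigD1 l)//= lerDl.
      by apply: sumr_ge0 => j _; exact: sqr_ge0.
    have := sqr_sqrtr (f2 l); have := sqr_sqrtr (ltW (lam0 l)).
    (* With [a = sqrt lam] and [b = sqrt h], [2 a^2 + 2 (a - b)^2 - b^2 = (2 a - b)^2]; this is the
       origin of the bound [2 lam + 2 P]. *)
    by have := sqr_ge0 (2 * Num.sqrt (lam l) - Num.sqrt (h l)); nra.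
  have /andP[gl0 gl1] := f1 l; rewrite gl1 andbT.
  (* All rates are nonnegative, so each is at most twice the objective. The resulting lower bound
     keeps [gam] away from 0, where the objective is not continuous. *)
  have : ln (lam l / g l) <= 2 * c0.
    rewrite -ler_pdivrMl//; apply: le_trans gc.
    rewrite /rdp_objective ler_pM2l// (bigD1 l)//= lerDl.
    by apply: sumr_ge0 => j _; exact: rdp_rate_ge0.
  rewrite -ler_expR lnK ?posrE ?divr_gt0// ler_pdivrMr// expRN.
  by rewrite ler_pdivrMr ?expR_gt0// mulrC.
have [f0 Kf0 _] := toK h0 g0 feas0 (lexx _).
have cobj : {within K, continuous (fun f => rdp_objective lam (gam f))}.
  apply: continuous_in_subspaceT => f /set_mem Kf.
  by apply: (cvg_rdp_objective (@cvg_gam f) lam0) => l; exact: Kpos.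
have [f /set_mem Kf fmin] := compact_EVT_min (ex_intro _ f0 Kf0) cK cobj.
exists (lamh f), (gam f); split; first exact: Kfeas.
move=> h' g' feas'; have [gc|/ltW gc] := leP (rdp_objective lam g') c0.
  by have [f' Kf' [_ <-]] := toK _ _ feas' gc; exact/fmin/mem_set.
apply: le_trans gc; rewrite /c0; have [f' Kf' [_ <-]] := toK h0 g0 feas0 (lexx _).
exact/fmin/mem_set.
Qed.

End minimum.

(** * The two inequalities between information and program *)

Section rdp_bounds.
Context {R : realType} {L : nat} (Theta : 'M[R]_L) (lam : 'I_L -> R).
Context (PX : probability (L.-tuple R) R).
Hypotheses (ThetaK : Theta^T *m Theta = 1%:M) (lam0 : forall l, 0 < lam l).
Hypothesis gPX : gaussian_law PX (covmx Theta lam).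
Variables (D P : R).

(* Shrinking [gam] by [expR (- eta)] makes all correlations positive and costs
   [L * eta / 2] in the objective. *)
Lemma RDP_le_objective lamh gam : rdp_feasible lam D P lamh gam ->
  (RDP PX D P <= (rdp_objective lam gam)%:E)%E.
Proof.
move=> [g01 h0 hD hP]; apply/lee_addgt0Pr => e e0.
(* The loss [L * eta / 2] is then [e * L / (L + 1) <= e]; the successor covers [L = 0]. *)
pose eta := 2 * e / L.+1%:R.
have eta0 : 0 < eta by rewrite divr_gt0 ?mulr_gt0.
have ee0 : 0 < expR (- eta) by exact: expR_gt0.
have ee1 : expR (- eta) < 1 by rewrite -[ltRHS]expR0 ltr_expR oppr_lt0.
pose c l := expR (- eta) * gam l / lam l.
have c01 l : 0 < c l < 1.
  have /andP[g0 gl] := g01 l; rewrite divr_gt0 ?mulr_gt0//=.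
  by rewrite ltr_pdivrMr// mul1r (lt_le_trans _ gl)// gtr_pMl.
(* The value [gam] corresponds to the squared correlation [1 - gam / lam]. Shrinking [gam] raises
   the correlation, so the distortion can only decrease. *)
pose r l := Num.sqrt (1 - c l).
have r2 l : r l ^+ 2 = 1 - c l.
  by rewrite sqr_sqrtr// subr_ge0 ltW//; case/andP: (c01 l).
have r01 l : 0 < r l < 1.
  have /andP[c0 c1] := c01 l.
  rewrite sqrtr_gt0 subr_gt0 c1/= -[ltRHS]sqrtr1 ltr_sqrt// gtrBl.
  exact: c0.
apply: le_trans (RDP_le ThetaK lam0 gPX h0 r01 (D := D) (Q := P) _ hP) _.
  apply: le_trans hD; apply: ler_sum => l _.
  have /andP[g0 gl] := g01 l.
  rewrite lerD2r lerD2l lerN2 ler_pM2l// mulrAC -sqrtrM ?(ltW (lam0 l))//.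
  rewrite [leRHS]mulrC -sqrtrM// ler_wsqrtr// ler_wpM2l//.
  have -> : lam l * (1 - c l) = lam l - expR (- eta) * gam l.
    by rewrite /c; field; rewrite gt_eqF.
  by rewrite lerD2l lerN2 ger_pMl// ltW.
rewrite -EFinD lee_fin /rdp_objective.
have lnE l : - ln (1 - r l ^+ 2) = ln (lam l / gam l) + eta.
  have /andP[g0 gl] := g01 l.
  rewrite r2 opprB addrCA subrr addr0 -lnV ?posrE; last by case/andP: (c01 l).
  rewrite /c expRN; have -> : ((expR eta)^-1 * gam l / lam l)^-1 =
    lam l / gam l * expR eta.
    by field; rewrite !gt_eqF// expR_gt0.
  by rewrite lnM ?posrE ?expR_gt0 ?divr_gt0// expRK.
under eq_bigr do rewrite lnE.
rewrite big_split/= mulrDr lerD2l sumr_const card_ord -[eta *+ L]mulr_natr.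
have L0 : 0 < L.+1%:R :> R by rewrite ltr0n.
have -> : 2^-1 * (eta * L%:R) = e * (L%:R / L.+1%:R).
  by rewrite /eta; field; rewrite gt_eqF.
by rewrite ger_pMr// ler_pdivrMr// mul1r ler_nat.
Qed.

Lemma objective_le_mutual_info k : (exp_distortion PX k <= D%:E)%E ->
  (W2sq PX (out_law PX k) <= P%:E)%E ->
  (ereal_inf [set (rdp_objective lam gam)%:E | gam in
     [set gam | exists lamh, rdp_feasible lam D P lamh gam]] <=
   mutual_info PX k)%E.
Proof.
move=> hD hP; have [J JE] := joint_law PX k.
have conv i := converse_feasible ThetaK lam0 gPX JE hD hP (i := i).
case: (mutual_info PX k) conv => [i| |] conv.
- have [lamh [gam [feas obj]]] := conv i (lexx _).
  apply: ge_ereal_inf; exists (rdp_objective lam gam)%:E; last by rewrite lee_fin.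
  by exists gam => //; exists lamh.
- exact: leey.
(* An information of [-oo] would yield a feasible objective of at most -1, although all rates are
   nonnegative. *)
have [lamh [gam [[g01 _ _ _] obj]]] := conv (- 1) (leNye _).
have o0 : 0 <= rdp_objective lam gam.
  by rewrite mulr_ge0//; apply: sumr_ge0 => l _; exact: rdp_rate_ge0.
by have := le_trans o0 obj; rewrite ler0N1.
Qed.

End rdp_bounds.

Theorem theorem5 (R : realType) (L : nat) (Theta : 'M[R]_L) (lam : 'I_L -> R)
    (PX : probability (L.-tuple R) R) :
  Theta^T *m Theta = 1%:M ->
  (forall l, 0 < lam l) ->
  gaussian_law PX (covmx Theta lam) ->
  forall D P : R,
    RDP PX D P =
      ereal_inf [set (rdp_objective lam gam)%:E | gam in
                   [set gam | exists lamh, rdp_feasible lam D P lamh gam]]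
    /\ ((exists lamh gam, rdp_feasible lam D P lamh gam) ->
        exists lamh gam, rdp_feasible lam D P lamh gam /\
                         RDP PX D P = (rdp_objective lam gam)%:E).
Proof.
move=> ThetaK lam0 gPX D P.
have RDPE : RDP PX D P = ereal_inf [set (rdp_objective lam gam)%:E | gam in
    [set gam | exists lamh, rdp_feasible lam D P lamh gam]].
  apply/eqP; rewrite eq_le; apply/andP; split.
    apply: le_ereal_inf_tmp => _ [gam [lamh feas] <-].
    exact: (RDP_le_objective ThetaK lam0 gPX feas).
  apply: le_ereal_inf_tmp => _ [k [hD hP] <-].
  exact: (objective_le_mutual_info ThetaK lam0 gPX hD hP).
split=> // feas; have [lamh [gam [fm hm]]] := rdp_minimum lam0 feas.
exists lamh, gam; split=> //; rewrite RDPE; apply/eqP; rewrite eq_le; apply/andP; split.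
  by apply: ereal_inf_lbound; exists gam => //; exists lamh.
apply: le_ereal_inf_tmp => _ [gam' [lamh' feas'] <-].
by rewrite lee_fin; exact: hm feas'.
Qed.
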